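(* For every $\alpha\in(0,2]$ there is a constant $c(\alpha)>0$ depending only on $\alpha$ such that the following holds. Let $m,n\ge1$, $p\in[0,1]$, and let $\{\delta_i\}_{1\le i\le n}$ and $\{\zeta_i\}_{1\le i\le n}$ be two sequences of random variables that are independent of each other, where $\delta_1,\dots,\delta_n$ are independent with $\delta_i\sim\mathrm{Bernoulli}(p)$, and $\zeta_1,\dots,\zeta_n$ are independent $\alpha$-sub-exponential random variables with mean $0$ and variance $1$. Put $\xi=(\xi_1,\dots,\xi_n)^\top$ with $\xi_i=\delta_i\zeta_i$, let $A$ be a fixed real $m\times n$ matrix, and let $L(\alpha)=\max_i\|\zeta_i\|_{\Psi_\alpha}$. Then for all $t\ge0$, $$\mathbb{P}\left\{\big|\|A\xi\|_2-\sqrt p\,\|A\|_F\big|>L(\alpha)^2t\right\}\le2\exp\left\{-c(\alpha)\min\left\{\left(\frac{t}{\|A\|_{l_2\to l_2}}\right)^2,\ \left(\frac{t}{\|A\|_{l_2\to l_2}}\right)^\alpha\right\}\right\}.$$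
   Context: $\delta\sim\mathrm{Bernoulli}(p)$ means $\delta\in\{0,1\}$ with $\mathbb{P}(\delta=1)=p$. A random variable $\eta$ is $\alpha$-sub-exponential if for some $K>0$, $\mathbb{P}\{|\eta|\ge t\}\le2\exp(-t^\alpha/K^\alpha)$ for all $t\ge0$; $\|\eta\|_{\Psi_\alpha}=\inf\{t>0:\mathbb{E}\exp(|\eta|^\alpha/t^\alpha)\le2\}$. $\|\cdot\|_2$ is the Euclidean norm, $\|A\|_F$ the Frobenius norm, $\|A\|_{l_2\to l_2}$ the spectral norm. Quotients with zero denominator (case $A=0$) are read as $x/0=+\infty$ for $x>0$ and $0/0=0$. *)

(* Defs.v *)
From HB Require Import structures.
From mathcomp Require Import all_boot all_order all_algebra.
From mathcomp Require Import all_classical all_reals all_analysis.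

Set Implicit Arguments.
Unset Strict Implicit.
Unset Printing Implicit Defensive.

Import Order.TTheory GRing.Theory Num.Theory.
Import numFieldNormedType.Exports.

Local Open Scope classical_set_scope.
Local Open Scope ring_scope.

Section matrix_norms.
Context {R : realType}.

Definition l2norm n (x : 'cV[R]_n) : R := Num.sqrt (\sum_i x i 0 ^+ 2).

Definition frobenius_norm m n (A : 'M[R]_(m, n)) : R :=
  Num.sqrt (\sum_i \sum_j A i j ^+ 2).

Definition spectral_norm m n (A : 'M[R]_(m, n)) : R :=
  sup [set l2norm (A *m x) | x in [set x : 'cV[R]_n | l2norm x <= 1]].

End matrix_norms.

Section random_variables.
Context {d : measure_display} {T : measurableType d} {R : realType}.
Context (P : probability T R).

Definition is_bernoulli (p : R) (X : {RV P >-> R}) : Prop :=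
  {ae P, forall w, X w = 0 \/ X w = 1} /\ P [set w | X w = 1] = p%:E.

Definition sub_exponential (alpha : R) (X : {RV P >-> R}) : Prop :=
  exists2 K : R, 0 < K & forall t : R, 0 <= t ->
    (P [set w | (t <= `|X w|)%R] <=
     (2 * expR (- (t `^ alpha / K `^ alpha)))%:E)%E.

(* Extended-real valued: the norm is +oo when no admissible t exists. *)
Definition psi_norm (alpha : R) (X : {RV P >-> R}) : \bar R :=
  ereal_inf [set t%:E | t in [set t : R | 0 < t /\
    ('E_P[fun w => expR (`|X w| `^ alpha / t `^ alpha)] <= 2%:E)%E]].

Definition mutually_independent n (X : 'I_n -> {RV P >-> R}) : Prop :=
  forall (J : {set 'I_n}) (B : 'I_n -> set R),
    (forall i, measurable (B i)) ->
    P (\bigcap_(i in [set` J]) (X i @^-1` B i)) =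
    (\prod_(i in J) P (X i @^-1` B i))%E.

(* Independence of the generated sigma-algebras; nothing is required of the
   joint law inside each of the two families. *)
Definition independent_families n k
    (X : 'I_n -> {RV P >-> R}) (Y : 'I_k -> {RV P >-> R}) : Prop :=
  forall A B : set T,
    g_sigma_preimage (fun i => X i : T -> R) A ->
    g_sigma_preimage (fun i => Y i : T -> R) B ->
    P (A `&` B) = (P A * P B)%E.

Definition max_psi_norm (alpha : R) n (X : 'I_n -> {RV P >-> R}) : \bar R :=
  \big[Order.max/-oo%E]_(i < n) psi_norm alpha (X i).

End random_variables.

(* The quotient t / s taken in \bar R, where 0^-1 = +oo and 0 * +oo = 0: for
   t >= 0 this gives t / 0 = +oo when 0 < t, and 0 / 0 = 0. *)
Definition ediv {R : realType} (t s : R) : \bar R := (t%:E / s%:E)%E.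

(* Main.v *)
Require Import Defs.
From HB Require Import structures.
From mathcomp Require Import all_boot all_order all_algebra.
From mathcomp Require Import all_classical all_reals all_analysis.
From mathcomp Require Import measurable_realfun ring lra zify.

(** Normalise [A] to have spectral norm 1. For [t] below a constant the bound
    exceeds 1, and above it the minimum is [t^alpha]; so it suffices to show,
    for every integer [k >= 1], that [| |A xi| - sqrt p |A|_F |] exceeds a
    constant times [tau = L^2 k^(1/alpha)] with probability at most [exp (-k)].
    By Markov's inequality this follows from the moment bound
    [E (|A xi|^2 - p |A|_F^2)^(2k) <= (C tau^2 (p |A|_F^2 + tau^2))^k].

    Split [|A xi|^2 - p |A|_F^2] into its diagonal and off-diagonal parts. The
    diagonal part is a sum of independent centred variables. In the off-diagonal
    part average over all splittings of the index set into two halves; given one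
    half, it is a linear form in the other, whose moments are compared with
    Gaussian ones by integrating out one coordinate at a time. Its coefficients
    have squared norm at most [|A xi|^2], so the 2k-th moment of the off-diagonal
    part is bounded by [(C L^2 k^(2/alpha))^k E |A xi|^(2k)], and this
    inequality can be solved for the moments of [|A xi|].

    For a fixed [k] the heavy tails only enter through the factor
    [k^(2/alpha - 1)]: up to it the moments of [zeta] of order at most [4k] are
    sub-Gaussian. *)

Set Implicit Arguments.
Unset Strict Implicit.
Unset Printing Implicit Defensive.

Import Order.TTheory GRing.Theory Num.Theory.
Import numFieldNormedType.Exports.

Local Open Scope classical_set_scope.
Local Open Scope ring_scope.

(** Two obstacles shape the proof. For [alpha < 1] the entries need not have exponential moments,
    and the form has degree two in them, so no generating function is available; hence finite
    moments, one order for each scale [k]. Moreover [p] may be arbitrarily small, and the deviation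
    of the norm must not degrade with it. With [X = |A xi|^2] and [b = p |A|_F^2], a deviation of
    [sqrt X] from [sqrt b] by more than [M tau] forces [(X - b)^2 >= M^2 tau^2 (b + tau^2) / 2].
    This dictates the shape of the moment bound, in which [tau^2 b] is linear in [p]. For the
    diagonal part the factor [p] has to be carried along: [xi_i^4] has mean of order at most
    [p L^4], so after normalisation the variance is of order at most [p L^4 |A|_F^2], and this is
    the origin of [L^2] in [tau]. Lower powers of [L] are absorbed because unit variance bounds [L]
    from below. The off-diagonal part inherits [b + tau^2] from the moments of [X] itself. The
    algebra is done for an abstract expectation, where conditioning becomes a statement about which
    variables occur in a polynomial. *)

(** * Moments of linear forms and of sums of centred squares *)

Lemma sum_even_odd (V : nmodType) (F : nat -> V) k :
  \sum_(i < (k.*2).+1) F i =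
  F 0%N + \sum_(j < k) (F j.*2.+1 + F j.*2.+2).
Proof.
elim: k => [|k IH]; first by rewrite big_ord_recr !big_ord0 /= add0r addr0.
by rewrite doubleS 2!big_ord_recr/= IH [in RHS]big_ord_recr/= !addrA.
Qed.

(** A converse of log-concavity up to the factor 4: the quotient of the squared middle coefficient
    by the product of its neighbours is [(N - i) / (N - i - 1)] times [(i + 2) / (i + 1)], both at
    most 2. The 4 is exactly what a discriminant allows. *)
Lemma bin_log_concave N i : (i.+2 <= N)%N ->
  ('C(N, i.+1) * 'C(N, i.+1) <= 4 * ('C(N, i) * 'C(N, i.+2)))%N.
Proof.
move=> iN.
have e1 := mul_bin_left N i; have e2 := mul_bin_left N i.+1.
have e3 : ((N - i.+1) * 'C(N, i.+1) = i.+2 * 'C(N, i.+2))%N by rewrite -e2.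
have h : ((N - i) * i.+2 <= 4 * (i.+1 * (N - i.+1)))%N.
  rewrite -(subnKC iN); move: (N - i.+2)%N => d.
  have -> : (i.+2 + d - i = d.+2)%N by lia.
  have -> : (i.+2 + d - i.+1 = d.+1)%N by lia.
  nia.
have p : (0 < i.+1 * (N - i.+1))%N by rewrite muln_gt0/= subn_gt0.
rewrite -(leq_pmul2l p).
have -> : (i.+1 * (N - i.+1) * ('C(N, i.+1) * 'C(N, i.+1)) =
   (i.+1 * 'C(N, i.+1)) * ((N - i.+1) * 'C(N, i.+1)))%N by nia.
rewrite e1 e3.
have -> : ((N - i) * 'C(N, i) * (i.+2 * 'C(N, i.+2)) =
   ((N - i) * i.+2) * ('C(N, i) * 'C(N, i.+2)))%N by nia.
have -> : (i.+1 * (N - i.+1) * (4 * ('C(N, i) * 'C(N, i.+2))) =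
   (4 * (i.+1 * (N - i.+1))) * ('C(N, i) * 'C(N, i.+2)))%N by nia.
by rewrite leq_mul2r h orbT.
Qed.

Section real_inequalities.
Context {R : realFieldType}.
Implicit Types x y : R.

Lemma discriminant_bound (a b c x y : R) : 0 <= a -> 0 <= c ->
  b ^+ 2 <= 4 * (a * c) -> b * (x * y) <= a * y ^+ 2 + c * x ^+ 2.
Proof.
move=> a0 c0 hb; rewrite le_eqVlt in a0; case/orP: a0 => [/eqP a0|a0].
  have b0 : b = 0 by apply/eqP; rewrite -sqrf_eq0 eq_le sqr_ge0 andbT;
    move: hb; rewrite -a0 mul0r mulr0.
  by rewrite b0 -a0 !mul0r add0r mulr_ge0// sqr_ge0.
(* Multiplying by [4 * a] completes the square, which is why [a = 0] was treated apart. *)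
rewrite -subr_ge0 -(pmulr_rge0 _ a0) -(@pmulr_rge0 _ 4)//.
have -> : 4 * (a * (a * y ^+ 2 + c * x ^+ 2 - b * (x * y))) =
  (2 * a * y - b * x) ^+ 2 + (4 * (a * c) - b ^+ 2) * x ^+ 2 by ring.
by rewrite addr_ge0 ?sqr_ge0// mulr_ge0 ?sqr_ge0// subr_ge0.
Qed.

(* The odd terms of the binomial expansion beyond the linear one are absorbed
   by their two even neighbours. *)
Lemma even_exprD_le k x y :
  (y + x) ^+ k.*2 <= y ^+ k.*2 + (k.*2)%:R * (x * y ^+ k.*2.-1) +
    3 * \sum_(j < k) 'C(k.*2, j.*2.+2)%:R * x ^+ j.*2.+2 * y ^+ (k.*2 - j.*2.+2).
Proof.
case: k => [|k]; first by rewrite !big_ord0 !mul0r mulr0 !addr0 !expr0.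
pose F i := 'C(k.+1.*2, i)%:R * x ^+ i * y ^+ (k.+1.*2 - i).
have Fev i : 0 <= F i.*2.
  by rewrite /F -doubleB; apply: mulr_ge0; [apply: mulr_ge0 => //|];
    apply: exprn_even_ge0; rewrite odd_double.
rewrite exprDn (eq_bigr (fun i : 'I_k.+1.*2.+1 => F i)); last first.
  by move=> i _; rewrite /F -mulr_natl -mulrA [y ^+ _ * _]mulrC.
rewrite sum_even_odd big_split/= /F bin0 expr0 subn0 !mul1r -addrA lerD2l.
(* An even power factors out of the three terms and leaves a binary quadratic form in [x] and [y],
   nonnegative by its discriminant. *)
have step j : (j < k)%N -> F j.*2.+3 <= F j.*2.+2 + F j.*2.+4.
  move=> jk; rewrite /F.
  have -> : (k.+1.*2 - j.*2.+2 = (k - j.+1).*2.+2)%N by lia.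
  have -> : (k.+1.*2 - j.*2.+3 = (k - j.+1).*2.+1)%N by lia.
  have -> : (k.+1.*2 - j.*2.+4 = (k - j.+1).*2)%N by lia.
  set u := (k - j.+1)%N; set N := k.+1.*2.
  have -> : 'C(N, j.*2.+3)%:R * x ^+ j.*2.+3 * y ^+ u.*2.+1 =
     (x ^+ j.+1 * y ^+ u) ^+ 2 * ('C(N, j.*2.+3)%:R * (x * y)).
    by rewrite exprMn -!exprM muln2 (muln2 u) doubleS !exprS; ring.
  have -> : 'C(N, j.*2.+2)%:R * x ^+ j.*2.+2 * y ^+ u.*2.+2 +
      'C(N, j.*2.+4)%:R * x ^+ j.*2.+4 * y ^+ u.*2 =
     (x ^+ j.+1 * y ^+ u) ^+ 2 *
       ('C(N, j.*2.+2)%:R * y ^+ 2 + 'C(N, j.*2.+4)%:R * x ^+ 2).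
    by rewrite exprMn -!exprM muln2 (muln2 u) doubleS !exprS; ring.
  apply: ler_wpM2l; first exact: sqr_ge0.
  apply: discriminant_bound => //.
  by rewrite expr2 -!natrM ler_nat bin_log_concave// /N; lia.
(* Origin of the factor 3: each even term counts once for itself and at most once for each of its
   two odd neighbours. *)
pose S0 := \sum_(i < k) F i.*2.+2; pose S1 := \sum_(i < k) F i.*2.+4.
have h1 : \sum_(i < k) F i.*2.+3 <= S0 + S1.
  by rewrite -big_split/=; apply: ler_sum => i _; exact: step.
have h2 : \sum_(i < k.+1) F i.*2.+2 = F 2%N + S1 by rewrite big_ord_recl.
have h3 : S0 <= F 2%N + S1.
  by rewrite -h2 big_ord_recr/= lerDl; exact: (Fev k.+1).
have h4 : \sum_(i < k.+1) F i.*2.+1 = F 1%N + \sum_(i < k) F i.*2.+3.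
  by rewrite big_ord_recl.
have F1 : F 1%N = (k.+1.*2)%:R * (x * y ^+ k.+1.*2.-1).
  by rewrite /F bin1 expr1 mulrA; congr (_ * _ ^+ _); lia.
rewrite -F1 -[leLHS]/(\sum_(i < k.+1) F i.*2.+1 + \sum_(i < k.+1) F i.*2.+2).
rewrite -[X in _ <= _ + _ * X]/(\sum_(i < k.+1) F i.*2.+2) h2 h4.
by have := Fev 1%N; rewrite -/(F 2%N); lra.
Qed.

End real_inequalities.

Section polynomial_functions.
Context {R : realType} {T : Type} {I : Type} (x : I -> T -> R).

(** A predicate on functions rather than on formal polynomials, so that integrands need no
    reification. The set [J] of admissible variables is how independence is expressed: a function
    polynomial in the variables other than [i] factors out of an expectation against powers of
    [x i]. *)
Inductive polyfun (J : set I) : (T -> R) -> Prop :=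
| polyfun_cst c : polyfun J (fun=> c)
| polyfun_var i : J i -> polyfun J (x i)
| polyfunD f g : polyfun J f -> polyfun J g -> polyfun J (fun w => f w + g w)
| polyfunM f g : polyfun J f -> polyfun J g -> polyfun J (fun w => f w * g w).

Lemma polyfunS (J J' : set I) f : J `<=` J' -> polyfun J f -> polyfun J' f.
Proof.
move=> JJ'; elim=> [c|i /JJ' Ji|g h _ ? _ ?|g h _ ? _ ?];
  [exact: polyfun_cst|exact: polyfun_var|exact: polyfunD|exact: polyfunM].
Qed.

Lemma polyfunX (J : set I) f r : polyfun J f -> polyfun J (fun w => f w ^+ r).
Proof.
move=> pf; elim: r => [|r IH]; first exact: polyfun_cst.
by under eq_fun do rewrite exprS; exact: polyfunM.
Qed.

Lemma polyfunB (J : set I) f g : polyfun J f -> polyfun J g ->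
  polyfun J (fun w => f w - g w).
Proof.
move=> pf pg; under eq_fun do rewrite -mulN1r.
by apply: polyfunD => //; apply: polyfunM => //; exact: polyfun_cst.
Qed.

Lemma polyfunZ (J : set I) c f : polyfun J f -> polyfun J (fun w => c * f w).
Proof. by apply: polyfunM; exact: polyfun_cst. Qed.

Lemma polyfun_sum (J : set I) (K : Type) (s : seq K) (Q : pred K)
    (f : K -> T -> R) :
  (forall i, Q i -> polyfun J (f i)) ->
  polyfun J (fun w => \sum_(i <- s | Q i) f i w).
Proof.
move=> pf; elim: s => [|a s IH].
  by under eq_fun do rewrite big_nil; exact: polyfun_cst.
under eq_fun do rewrite big_cons.
by case: (boolP (Q a)) => [Qa|_] //; apply: polyfunD => //; exact: pf.
Qed.

Lemma polyfun_varT i : polyfun setT (x i).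
Proof. exact: polyfun_var. Qed.

Lemma polyfun_var1 i : polyfun [set i] (x i).
Proof. exact: polyfun_var. Qed.

End polynomial_functions.

#[global] Hint Resolve polyfun_cst polyfun_varT polyfun_var1 polyfunD polyfunM polyfunX
  polyfunB : polyfun.

(* An expectation restricted to the functions polynomial in the independent
   variables x i; the moment method needs nothing else from measure theory. *)
Record expectation_functional {R : realType} {T : Type} {I : Type}
    (x : I -> T -> R) (E : (T -> R) -> R) : Prop := {
  ef_lin : forall a f g, polyfun x setT f -> polyfun x setT g ->
    E (fun w => a * f w + g w) = a * E f + E g ;
  ef_le : forall f g, polyfun x setT f -> polyfun x setT g ->
    (forall w, f w <= g w) -> E f <= E g ;
  ef_1 : E (fun=> 1) = 1 ;
  ef_indep : forall i r f, polyfun x (~` [set i]) f ->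
    E (fun w => x i w ^+ r * f w) = E (fun w => x i w ^+ r) * E f }.

Section expectation_functional_theory.
Context {R : realType} {T : Type} {I : eqType} (x : I -> T -> R)
  (E : (T -> R) -> R) (efE : expectation_functional x E).
Local Notation poly := (polyfun x).

Lemma polyfunT J f : poly J f -> poly setT f.
Proof. exact: polyfunS. Qed.

Lemma efD f g : poly setT f -> poly setT g ->
  E (fun w => f w + g w) = E f + E g.
Proof.
move=> pf pg; rewrite -[E f]mul1r -(ef_lin efE)//.
by congr E; apply/funext => w; rewrite mul1r.
Qed.

Lemma ef0 : E (fun=> 0) = 0.
Proof.
have /eqP := efD (polyfun_cst x setT 0) (polyfun_cst x setT 0).
rewrite -subr_eq0 opprD addrA.
under eq_fun do rewrite addr0.
by rewrite subrr sub0r oppr_eq0 => /eqP.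
Qed.

Lemma efZ a f : poly setT f -> E (fun w => a * f w) = a * E f.
Proof.
move=> pf; rewrite -[RHS]addr0 -ef0 -(ef_lin efE)//; last exact: polyfun_cst.
by congr E; apply/funext => w; rewrite addr0.
Qed.

Lemma ef_cst c : E (fun=> c) = c.
Proof.
rewrite -[RHS]mulr1 -(ef_1 efE) -efZ; last exact: polyfun_cst.
by congr E; apply/funext => w; rewrite mulr1.
Qed.

Lemma ef_sum (K : Type) (s : seq K) (Q : pred K) (f : K -> T -> R) :
  (forall i, Q i -> poly setT (f i)) ->
  E (fun w => \sum_(i <- s | Q i) f i w) = \sum_(i <- s | Q i) E (f i).
Proof.
move=> pf; elim: s => [|a s IH].
  by rewrite big_nil -[RHS]ef0; congr E; apply/funext => w; rewrite big_nil.
rewrite big_cons -IH.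
case: ifPn => [Qa|Qa].
  rewrite -efD; [|exact: pf|exact: polyfun_sum].
  by congr E; apply/funext => w; rewrite big_cons Qa.
by congr E; apply/funext => w; rewrite big_cons (negbTE Qa).
Qed.

Lemma ef_ge0 f : poly setT f -> (forall w, 0 <= f w) -> 0 <= E f.
Proof. by move=> pf f0; rewrite -ef0; apply: (ef_le efE) => //; auto with polyfun. Qed.

Lemma ef_sqr_le f : poly setT f -> E f ^+ 2 <= E (fun w => f w ^+ 2).
Proof.
move=> pf.
have := ef_ge0 (polyfunX 2 (polyfunB pf (polyfun_cst x setT (E f))))
  (fun w => sqr_ge0 _).
suff -> : E (fun w => (f w - E f) ^+ 2) = E (fun w => f w ^+ 2) - E f ^+ 2.
  by rewrite subr_ge0.
have -> : (fun w => (f w - E f) ^+ 2) =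
   (fun w => (- 2 * E f) * f w + (f w ^+ 2 + E f ^+ 2)).
  by apply/funext => w; ring.
rewrite (ef_lin efE); auto with polyfun.
by rewrite efD ?ef_cst; auto with polyfun; ring.
Qed.

Lemma ef_indep1 i f : poly (~` [set i]) f ->
  E (fun w => x i w * f w) = E (x i) * E f.
Proof. exact: (ef_indep efE 1). Qed.

(* Expanding one coordinate at a time: the linear term vanishes because the
   coordinate is centred, and [even_exprD_le] leaves only even moments. *)
Lemma ef_even_exprD_le k (u g y h : T -> R) (i : I) :
  poly (~` [set i]) g -> poly (~` [set i]) y -> poly (~` [set i]) h ->
  (forall w, 0 <= h w) ->
  poly [set i] u ->
  (forall r f, poly (~` [set i]) f ->
     E (fun w => u w ^+ r * f w) = E (fun w => u w ^+ r) * E f) ->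
  E u = 0 ->
  E (fun w => h w * (y w + u w * g w) ^+ k.*2) <=
  E (fun w => h w * y w ^+ k.*2) +
  3 * \sum_(j < k) 'C(k.*2, j.*2.+2)%:R * E (fun w => u w ^+ j.*2.+2) *
     E (fun w => h w * g w ^+ j.*2.+2 * y w ^+ (k.*2 - j.*2.+2)).
Proof.
move=> pg py ph h0 pu indep u0.
have [pgT pyT phT puT] : [/\ poly setT g, poly setT y, poly setT h & poly setT u].
  by split; apply: polyfunT; eassumption.
pose L w := u w * (h w * (g w * y w ^+ k.*2.-1)).
pose S (j : 'I_k) w := u w ^+ j.*2.+2 *
  (h w * g w ^+ j.*2.+2 * y w ^+ (k.*2 - j.*2.+2)).
have pL : poly setT L by rewrite /L; auto with polyfun.
have pS j : poly setT (S j) by rewrite /S; auto 8 with polyfun.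
have pSS : poly setT (fun w => \sum_(j < k) ('C(k.*2, j.*2.+2)%:R * S j w)).
  by apply: polyfun_sum => j _; exact: polyfunZ.
apply: (@le_trans _ _ (E (fun w => h w * y w ^+ k.*2 + (k.*2%:R * L w +
   3 * (\sum_(j < k) 'C(k.*2, j.*2.+2)%:R * S j w))))).
  apply: (ef_le efE); first by auto with polyfun.
    by apply: polyfunD; [auto with polyfun|apply: polyfunD; exact: polyfunZ].
  move=> w; apply: le_trans (ler_wpM2l (h0 w) (even_exprD_le k _ _)) _.
  rewrite /L le_eqVlt; apply/orP; left; apply/eqP.
  rewrite !mulrDr addrA; congr (_ + _ + _); first by ring.
  rewrite mulrCA; congr (_ * _); rewrite mulr_sumr; apply: eq_bigr => j _.
  by rewrite /S exprMn; ring.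
rewrite efD; [|by auto with polyfun|by apply: polyfunD; exact: polyfunZ].
rewrite lerD2l efD; [|exact: polyfunZ|exact: polyfunZ].
rewrite !efZ// /L.
have -> : E (fun w => u w * (h w * (g w * y w ^+ k.*2.-1))) = 0.
  have /= -> := indep 1%N (fun w => h w * (g w * y w ^+ k.*2.-1)).
    by rewrite u0 mul0r.
  by auto with polyfun.
rewrite mulr0 add0r ler_wpM2l// ef_sum; last by move=> j _; exact: polyfunZ.
apply: ler_sum => j _; rewrite efZ// -mulrA /S indep//.
by auto with polyfun.
Qed.

End expectation_functional_theory.

(* Up to the factor 2^r, the moment of order 2r of a standard Gaussian. *)
Definition gauss_weight {R : realFieldType} (r : nat) : R := (r.*2)`!%:R / r`!%:R.

(** The additivity of variances for independent Gaussians, moment by moment: the even terms of an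
    expansion with Gaussian weights reassemble into a binomial expansion of the variances. *)
Lemma gauss_weight_bin {R : realFieldType} r j : (j <= r)%N ->
  'C(r.*2, j.*2)%:R * gauss_weight j * gauss_weight (r - j) =
  gauss_weight r * 'C(r, j)%:R :> R.
Proof.
move=> jr; have fne k : k`!%:R != 0 :> R by rewrite pnatr_eq0 -lt0n fact_gt0.
have e1 : 'C(r.*2, j.*2)%:R * ((j.*2)`!%:R * ((r - j).*2)`!%:R) =
    (r.*2)`!%:R :> R.
  by rewrite -!natrM doubleB bin_fact// leq_double.
have e2 : 'C(r, j)%:R * (j`!%:R * (r - j)`!%:R) = r`!%:R :> R.
  by rewrite -!natrM bin_fact.
rewrite /gauss_weight -e1 -e2; field.
have := fne r; rewrite -e2 !mulf_eq0 !negb_or => /andP[-> _].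
by rewrite !fne.
Qed.

Lemma gauss_weight_ge0 {R : realFieldType} r : 0 <= gauss_weight r :> R.
Proof. by rewrite divr_ge0. Qed.

Lemma gauss_weight0 {R : realFieldType} : gauss_weight 0 = 1 :> R.
Proof. by rewrite /gauss_weight divr1. Qed.

Section moment_bounds.
Context {R : realType} {T : Type} {I : eqType} (x : I -> T -> R)
  (E : (T -> R) -> R) (efE : expectation_functional x E).
Local Notation poly := (polyfun x).

(** Each coordinate is compared with a Gaussian. The factor 3 of the one-coordinate expansion
    affects only terms of positive degree in that coordinate, so it enlarges the variance and does
    not accumulate along [s]. The coefficients may be random, provided that they avoid the variables
    in [s]; the weight [h] collects the powers of the coefficients already split off. *)
Lemma linear_form_moment (K : R) (k : nat) (s : seq I) (b : I -> T -> R)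
    (J : set I) (h : T -> R) (r : nat) : 0 <= K ->
  (forall i, i \in s -> E (x i) = 0) ->
  (forall i j, i \in s -> (0 < j <= k)%N ->
     E (fun w => x i w ^+ j.*2) <= K ^+ j * gauss_weight j) ->
  uniq s -> (forall i, i \in s -> ~ J i) ->
  (forall i, i \in s -> poly J (b i)) -> poly J h -> (forall w, 0 <= h w) ->
  (r <= k)%N ->
  E (fun w => h w * (\sum_(i <- s) x i w * b i w) ^+ r.*2) <=
  (3 * K) ^+ r * gauss_weight r *
    E (fun w => h w * (\sum_(i <- s) b i w ^+ 2) ^+ r).
Proof.
move=> K0 Ex0 ExK; elim: s h r Ex0 ExK => [|i s IH] h r Ex0 ExK.
  move=> _ _ _ ph h0 rk.
  under [X in E X <= _]eq_fun do rewrite big_nil.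
  under [X in _ <= _ * E X]eq_fun do rewrite big_nil.
  case: r rk => [|r] rk.
    by rewrite gauss_weight0 expr0 !mul1r.
  under [X in E X <= _]eq_fun do rewrite expr0n mulr0.
  under [X in _ <= _ * E X]eq_fun do rewrite expr0n mulr0.
  by rewrite (ef0 efE) mulr0.
move=> /= /andP[is_ us] nJ pb ph h0 rk.
have mi : i \in i :: s by rewrite mem_head.
have ms j : j \in s -> j \in i :: s by rewrite inE => ->; rewrite orbT.
have Ji : J `<=` ~` [set i] by move=> j Jj /= ji; apply: (nJ i) => //; rewrite -ji.
have pbi j : j \in i :: s -> poly (~` [set i]) (b j).
  by move=> js; apply: (polyfunS Ji); exact: pb.
pose y w := \sum_(j <- s) x j w * b j w.
pose B w := \sum_(j <- s) b j w ^+ 2.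
have py : poly (~` [set i]) y.
  rewrite /y; under eq_fun do rewrite big_seq.
  apply: polyfun_sum => j js; apply: polyfunM; last exact/pbi/ms.
  by apply: polyfun_var => /= ji; move: is_; rewrite -ji js.
have pB : poly J B.
  rewrite /B; under eq_fun do rewrite big_seq.
  by apply: polyfun_sum => j js; apply/polyfunX/pb/ms.
have B0 w : 0 <= B w by rewrite /B sumr_ge0// => j _; exact: sqr_ge0.
have pi : poly J (b i) by exact: pb.
have phb j : poly J (fun w => h w * b i w ^+ j.*2) by auto with polyfun.
have hb0 j w : 0 <= h w * b i w ^+ j.*2.
  by rewrite mulr_ge0// exprn_even_ge0// odd_double.
pose e j := E (fun w => h w * b i w ^+ j.*2 * B w ^+ (r - j)).
have e0 j : 0 <= e j.
  apply: (ef_ge0 efE) => [|w]; last by rewrite mulr_ge0// exprn_ge0.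
  by apply: (@polyfunT _ _ _ _ J); auto with polyfun.
have IHj j : (j <= r)%N ->
    E (fun w => h w * b i w ^+ j.*2 * y w ^+ (r.*2 - j.*2)) <=
    (3 * K) ^+ (r - j) * gauss_weight (r - j) * e j.
  move=> jr; rewrite -doubleB; apply: IH => //.
  - by move=> l ls; apply/Ex0/ms.
  - by move=> l l' ls; apply/ExK/ms.
  - by move=> l ls; apply/nJ/ms.
  - by move=> l ls; apply/pb/ms.
  - by rewrite (leq_trans (leq_subr _ _)).
under [X in E X <= _]eq_fun do rewrite big_cons addrC.
apply: (le_trans (ef_even_exprD_le efE r (i := i) (u := x i) (g := b i)
   (y := y) (h := h) _ _ _ _ _ _ _)) => //.
- exact: pbi.
- exact: polyfunS ph.
- exact: polyfun_var.
- by move=> r' f; exact: (ef_indep efE).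
- exact: Ex0.
(* The right side is expanded in powers of [b i w ^+ 2], to be compared term by term with the
   left. *)
have -> : (3 * K) ^+ r * gauss_weight r *
    E (fun w => h w * (\sum_(j <- i :: s) b j w ^+ 2) ^+ r) =
  \sum_(j < r.+1) 'C(r.*2, j.*2)%:R * ((3 * K) ^+ j * gauss_weight j) *
     ((3 * K) ^+ (r - j) * gauss_weight (r - j) * e j).
  have -> : (fun w => h w * (\sum_(j <- i :: s) b j w ^+ 2) ^+ r) =
     (fun w => \sum_(j < r.+1) 'C(r, j)%:R *
       (h w * b i w ^+ j.*2 * B w ^+ (r - j))).
    apply/funext => w; rewrite big_cons addrC exprDn mulr_sumr.
    apply: eq_bigr => j _; rewrite -/(B w) -exprM mul2n -mulr_natl; ring.
  have pj (j : 'I_r.+1) : poly setT (fun w => h w * b i w ^+ j.*2 * B w ^+ (r - j)).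
    by apply: (@polyfunT _ _ _ _ J); auto with polyfun.
  rewrite (ef_sum efE); last by move=> j _; exact: polyfunZ.
  rewrite mulr_sumr; apply: eq_bigr => j _.
  rewrite (efZ efE)// -/(e j).
  have jr : (j <= r)%N by rewrite -ltnS.
  rewrite -{1}(subnKC jr) exprD mulrA -[_ * gauss_weight r * _]mulrA.
  by rewrite -(gauss_weight_bin jr); ring.
rewrite big_ord_recl/= bin0 expr0 gauss_weight0 !mul1r subn0; apply: lerD.
  have := IHj 0%N isT; rewrite subn0 subn0; under eq_fun do rewrite expr0 mulr1.
  by [].
(* In these terms the factor 3 is paid for by [3 <= 3 ^ j.+1]. *)
rewrite mulr_sumr; apply: ler_sum => j _; rewrite /bump/= add1n.
have jr : (j.+1 <= r)%N by [].
apply: (@le_trans _ _ (3 * ('C(r.*2, (j.+1).*2)%:R * (K ^+ j.+1 * gauss_weight j.+1)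
   * ((3 * K) ^+ (r - j.+1) * gauss_weight (r - j.+1) * e j.+1)))).
  rewrite ler_wpM2l// -mulrA -[leRHS]mulrA; apply: ler_wpM2l => //; apply: ler_pM.
  - apply: (ef_ge0 efE) => [|w]; last by rewrite exprn_even_ge0// -doubleS odd_double.
    by apply: polyfunX; exact: polyfun_var.
  - apply: (ef_ge0 efE) => [|w].
      apply: (@polyfunT _ _ _ _ (~` [set i])).
      apply: polyfunM; last exact: polyfunX.
      by apply: polyfunM; [exact: polyfunS ph|apply/polyfunX/pbi].
    rewrite mulr_ge0//; first exact: (hb0 j.+1).
    by rewrite -doubleS -doubleB exprn_even_ge0// odd_double.
  - by apply: (ExK i j.+1) => //=; rewrite (leq_trans jr).
  - exact: (IHj j.+1).
set X := (3 * K) ^+ (r - j.+1) * _ * _.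
have X0 : 0 <= X by rewrite !mulr_ge0 ?gauss_weight_ge0 ?exprn_ge0 ?mulr_ge0.
rewrite mulrA; apply: ler_wpM2r => //.
rewrite mulrCA; apply: ler_wpM2l => //.
rewrite mulrA; apply: ler_wpM2r; first exact: gauss_weight_ge0.
rewrite exprMn; apply: ler_wpM2r; first exact: exprn_ge0.
by rewrite -natrX ler_nat -{1}(expn1 3) leq_exp2l.
Qed.

(** Factorisation is given only for powers of [x i], so the power of the centred square is expanded
    into them. *)
Lemma ef_indep_sqrB (p : R) i r f : poly (~` [set i]) f ->
  E (fun w => (x i w ^+ 2 - p) ^+ r * f w) =
  E (fun w => (x i w ^+ 2 - p) ^+ r) * E f.
Proof.
move=> pf; have pfT := polyfunT pf.
have pX l : poly setT (fun w => x i w ^+ l) by auto with polyfun.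
have -> : (fun w => (x i w ^+ 2 - p) ^+ r) = (fun w => \sum_(l < r.+1)
    ((- p) ^+ l * 'C(r, l)%:R) * x i w ^+ (2 * (r - l))).
  apply/funext => w; rewrite exprDn; apply: eq_bigr => l _.
  by rewrite exprM -mulr_natr; ring.
have -> : (fun w => (x i w ^+ 2 - p) ^+ r * f w) = (fun w => \sum_(l < r.+1)
    ((- p) ^+ l * 'C(r, l)%:R) * (x i w ^+ (2 * (r - l)) * f w)).
  apply/funext => w; rewrite exprDn mulr_suml; apply: eq_bigr => l _.
  by rewrite exprM -mulr_natr; ring.
have pXf l : poly setT (fun w => x i w ^+ l * f w) by auto with polyfun.
rewrite (ef_sum efE); last by move=> l _; exact: polyfunZ.
rewrite (ef_sum efE); last by move=> l _; exact: polyfunZ.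
rewrite mulr_suml; apply: eq_bigr => l _.
by rewrite !(efZ efE)// (ef_indep efE)// mulrA.
Qed.

Lemma expr_subr_ge0_le (a b : R) r : 0 <= a -> 0 <= b ->
  (a - b) ^+ r.*2 <= a ^+ r.*2 + b ^+ r.*2.
Proof.
wlog ba : a b / b <= a.
  move=> hw a0 b0; case: (leP b a) => [ba|/ltW ab]; first exact: hw.
  have -> : (a - b) ^+ r.*2 = (b - a) ^+ r.*2.
    by rewrite -!mul2n !exprM; congr (_ ^+ _); ring.
  by rewrite [leRHS]addrC; exact: hw.
move=> a0 b0; apply: (@le_trans _ _ (a ^+ r.*2)).
  by rewrite lerXn2r// ?nnegrE ?subr_ge0// lerBlDr lerDl.
by rewrite lerDl exprn_ge0.
Qed.

Lemma geom_sum_le (q z : R) r : 0 <= q -> 0 <= z -> q * z <= 2^-1 ->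
  \sum_(j < r) q ^+ j * z ^+ j.+1 <= 2 * z.
Proof.
(* The partial sum of the geometric series of ratio [1/2] is a bound that the induction can
   carry. *)
move=> q0 z0 qz; suff : \sum_(j < r) q ^+ j * z ^+ j.+1 <= (2 - 2 * 2^-1 ^+ r) * z.
  move=> /le_trans; apply; apply: ler_wpM2r => //.
  by rewrite lerBlDr lerDl mulr_ge0// exprn_ge0.
elim: r => [|r IH]; first by rewrite big_ord0 expr0 mulr1 subrr mul0r.
rewrite big_ord_recr/= (le_trans (lerD IH (lexx _)))//.
have : q ^+ r * z ^+ r <= 2^-1 ^+ r.
  by rewrite -exprMn lerXn2r// nnegrE ?mulr_ge0.
move=> /(ler_wpM2r z0); rewrite !exprS [z * _]mulrC.
set A := 2^-1 ^+ r; rewrite -mulrA; set B := q ^+ r * _; lra.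
Qed.

(** A truncated form of Bernstein's inequality. With [z = lambda ^ 2], it bounds the term of order
    [2r] of the series of [E (cosh (lambda Y))] by the exponential that would bound the whole
    series, and it involves only finitely many moments. The constant 12 is [3 * 2 * 2]: the
    expansion, the centring, and the geometric series, which converges because [S ^+ 2 * z <= 1/2].
    Since [c i <= 1], the even powers of [c i] are replaced by [c i] itself. *)
Lemma centred_squares_moment (p V S z : R) (k : nat) (s : seq I) (c : I -> R) (r : nat) :
  0 <= p -> p <= 1 -> 1 <= V -> 1 <= S -> 0 < z -> S ^+ 2 * z <= 2^-1 ->
  (forall i, i \in s -> 0 <= c i <= 1) ->
  (forall i, i \in s -> E (fun w => x i w ^+ 2) = p) ->
  (forall i j, i \in s -> (j < k)%N ->
     E (fun w => (x i w ^+ 2) ^+ j.+1.*2) <=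
       p * V * (S ^+ 2) ^+ j * (j.+1.*2)`!%:R) ->
  uniq s -> (r <= k)%N ->
  E (fun w => (\sum_(i <- s) c i * (x i w ^+ 2 - p)) ^+ r.*2) <=
  (r.*2)`!%:R * z^-1 ^+ r * expR (12 * p * V * z * \sum_(i <- s) c i).
Proof.
move=> p0 p1 V1 S1 z0 Sz; elim: s r => [|i s IH] r c01 Ex2 Ex4 us rk.
  under [X in E X <= _]eq_fun do rewrite big_nil.
  rewrite big_nil mulr0 expR0 mulr1.
  case: r rk => [|r] rk; first by rewrite (ef_1 efE) expr0 mulr1.
  under [X in E X <= _]eq_fun do rewrite expr0n.
  by rewrite (ef0 efE) mulr_ge0// exprn_ge0// invr_ge0 ltW.
have [V0 S0] : 0 <= V /\ 0 <= S by split; rewrite (le_trans _ V1, le_trans _ S1).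
move: us => /= /andP[is_ us].
have mi : i \in i :: s by rewrite mem_head.
have ms j : j \in s -> j \in i :: s by rewrite inE => ->; rewrite orbT.
pose u w := x i w ^+ 2 - p.
pose y w := \sum_(j <- s) c j * (x j w ^+ 2 - p).
have pu : poly [set i] u by rewrite /u; auto with polyfun.
have py : poly (~` [set i]) y.
  rewrite /y; under eq_fun do rewrite big_seq.
  apply: polyfun_sum => j js; apply: polyfunZ; apply: polyfunB; last exact: polyfun_cst.
  by apply/polyfunX/polyfun_var => /= ji; move: is_; rewrite -ji js.
have u0 : E u = 0.
  rewrite /u; under eq_fun do rewrite addrC.
  rewrite (efD efE); [|exact: polyfun_cst|by auto with polyfun].
  by rewrite (ef_cst efE) Ex2// addNr.
(* Centring costs a factor 2 and keeps the factor [p], because positive powers of [p] are at most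
   [p]. *)
have uj j : (j < k)%N -> E (fun w => u w ^+ j.+1.*2) <=
    2 * (p * V * (S ^+ 2) ^+ j * (j.+1.*2)`!%:R).
  move=> jk; apply: (@le_trans _ _
    (E (fun w => (x i w ^+ 2) ^+ j.+1.*2 + p ^+ j.+1.*2))).
    apply: (ef_le efE) => [||w].
    - by apply/polyfunX/(polyfunT pu).
    - by auto with polyfun.
    - by apply: expr_subr_ge0_le => //; exact: sqr_ge0.
  rewrite (efD efE); [|by auto with polyfun..].
  rewrite mulr_natl mulr2n; apply: lerD; first exact: Ex4.
  rewrite (ef_cst efE) -!mulrA doubleS exprS; apply: ler_wpM2l => //.
  apply: (@le_trans _ _ 1); first by rewrite exprn_ile1.
  rewrite mulrA; apply: (@le_trans _ _ (1 * 1)); first by rewrite mulr1.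
  apply: ler_pM => //; last by rewrite ler1n fact_gt0.
  apply: (@le_trans _ _ (1 * 1)); first by rewrite mulr1.
  by apply: ler_pM => //; rewrite exprn_ege1// expr_ge1.
pose Q := expR (12 * p * V * z * \sum_(j <- s) c j).
have Q0 : 0 <= Q by exact: expR_ge0.
have IHj j : (j <= r)%N -> E (fun w => y w ^+ (r.*2 - j.*2)) <=
    (r.*2 - j.*2)`!%:R * z^-1 ^+ (r - j) * Q.
  move=> jr; rewrite -doubleB; apply: IH => //.
  - by move=> l /ms; exact: c01.
  - by move=> l /ms; exact: Ex2.
  - by move=> l l' /ms; exact: Ex4.
  - by rewrite (leq_trans (leq_subr _ _)).
have /andP[ci0 ci1] := c01 i mi.
have -> : (fun w => (\sum_(j <- i :: s) c j * (x j w ^+ 2 - p)) ^+ r.*2) =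
   (fun w => 1 * (y w + u w * c i) ^+ r.*2).
  by apply/funext => w; rewrite big_cons mul1r addrC [_ * c i]mulrC.
apply: (le_trans (ef_even_exprD_le efE r (i := i) (u := u) (g := fun=> c i)
   (y := y) (h := fun=> 1) _ _ _ _ _ _ _)) => //.
- exact: polyfun_cst.
- exact: polyfun_cst.
- by move=> r' f; exact: ef_indep_sqrB.
rewrite big_cons mulrDr expRD -/Q.
(* A coordinate multiplies the bound by [1 + y]; passing to [expR y] turns the product over
   coordinates into a sum in the exponent. *)
have eX : 1 + 12 * p * V * z * c i <= expR (12 * p * V * z * c i).
  exact: expR_ge1Dx.
set M := (r.*2)`!%:R * z^-1 ^+ r.
have M0 : 0 <= M by rewrite mulr_ge0// exprn_ge0// invr_ge0 ltW.
apply: (@le_trans _ _ (M * (1 + 12 * p * V * z * c i) * Q)); last first.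
  by rewrite [in leRHS]mulrA; apply: ler_wpM2r => //; exact: ler_wpM2l.
rewrite mulrDr mulr1 mulrDl; apply: lerD.
  under [X in E X <= _]eq_fun do rewrite mul1r.
  by have := IHj 0%N isT; rewrite !subn0.
apply: (@le_trans _ _ (3 * \sum_(j < r) (M * Q * (c i * (2 * (p * V)))) *
   ((S ^+ 2) ^+ j * z ^+ j.+1))).
  apply: ler_wpM2l => //; apply: ler_sum => j _.
  have jr : (j.+1 <= r)%N by [].
  have -> : (fun w => 1 * c i ^+ j.*2.+2 * y w ^+ (r.*2 - j.*2.+2)) =
     (fun w => c i ^+ j.*2.+2 * y w ^+ (r.*2 - j.+1.*2)).
    by apply/funext => w; rewrite mul1r.
  have pyj : poly setT (fun w => y w ^+ (r.*2 - j.+1.*2)).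
    exact/polyfunX/(polyfunT py).
  rewrite (efZ efE)//.
  apply: (@le_trans _ _ ('C(r.*2, j.+1.*2)%:R *
     (2 * (p * V * (S ^+ 2) ^+ j * (j.+1.*2)`!%:R)) *
     (c i * ((r.*2 - j.+1.*2)`!%:R * z^-1 ^+ (r - j.+1) * Q)))).
    rewrite -mulrA -[leRHS]mulrA; apply: ler_wpM2l => //; apply: ler_pM.
    - apply: (ef_ge0 efE) => [|w]; first exact/polyfunX/(polyfunT pu).
      by rewrite exprn_even_ge0// -doubleS odd_double.
    - apply: mulr_ge0; first exact: exprn_ge0.
      apply: (ef_ge0 efE) => // w.
      by rewrite -doubleB exprn_even_ge0// odd_double.
    - by apply: (uj j); exact: leq_trans rk.
    - apply: ler_pM.
      + exact: exprn_ge0.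
      + apply: (ef_ge0 efE) => // w.
        by rewrite -doubleB exprn_even_ge0// odd_double.
      + by rewrite exprS ler_piMr// exprn_ile1.
      + exact: (IHj j.+1).
  (* The binomial coefficient cancels the factorials of the two moments. *)
  rewrite le_eqVlt; apply/orP; left; apply/eqP.
  have hb : 'C(r.*2, j.+1.*2)%:R * ((j.+1.*2)`!%:R * (r.*2 - j.+1.*2)`!%:R) =
      (r.*2)`!%:R :> R.
    by rewrite -!natrM bin_fact// leq_double.
  have hz : z^-1 ^+ (r - j.+1) = z^-1 ^+ r * z ^+ j.+1.
    have zr : z^-1 ^+ r = z^-1 ^+ (r - j.+1) * z^-1 ^+ j.+1.
      by rewrite -exprD subnK.
    by rewrite zr -mulrA -exprMn mulVf ?expr1n ?mulr1// gt_eqF.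
  by rewrite hz /M -hb; ring.
rewrite -mulr_sumr.
have G := geom_sum_le r (sqr_ge0 S) (ltW z0) Sz.
rewrite mulrA.
apply: (le_trans (ler_wpM2l _ G)).
  by do ?[done | apply: mulr_ge0].
by rewrite le_eqVlt; apply/orP; left; apply/eqP; ring.
Qed.

End moment_bounds.

(** * Moments of quadratic forms *)

(** A convex function lies above its tangents. The power-mean bound and the conditional Jensen
    inequality below rest on this pointwise form, to which a linear monotone expectation applies. *)
Lemma expr_tangent_le {R : realFieldType} (a b : R) k : 0 <= a -> 0 <= b ->
  a ^+ k + k%:R * (a ^+ k.-1 * (b - a)) <= b ^+ k.
Proof.
move=> a0 b0; elim: k => [|[|k] IH]; first by rewrite !expr0 mul0r addr0.
  by rewrite !expr1 expr0 !mul1r addrC subrK.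
have := ler_wpM2l b0 IH; rewrite -exprS; apply: le_trans.
rewrite -subr_ge0.
suff -> : b * (a ^+ k.+1 + k.+1%:R * (a ^+ k.+1.-1 * (b - a))) -
  (a ^+ k.+2 + k.+2%:R * (a ^+ k.+2.-1 * (b - a))) =
  k.+1%:R * a ^+ k * (b - a) ^+ 2.
  by apply: mulr_ge0; [apply: mulr_ge0 => //; exact: exprn_ge0|exact: sqr_ge0].
by rewrite /= !exprS -[k.+2%:R]natr1; ring.
Qed.

Lemma even_expr_tangent_le {R : realFieldType} (a b : R) k :
  a ^+ k.*2 + (k%:R * (a ^+ 2) ^+ k.-1 * (2 * a)) * (b - a) <= b ^+ k.*2.
Proof.
rewrite -!mul2n !exprM; have := expr_tangent_le k (sqr_ge0 a) (sqr_ge0 b).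
apply: le_trans; rewrite lerD2l -!mulrA; apply: ler_wpM2l => //.
apply: ler_wpM2l; first by rewrite exprn_ge0// sqr_ge0.
rewrite -subr_ge0; have -> : b ^+ 2 - a ^+ 2 - 2 * (a * (b - a)) = (b - a) ^+ 2 by ring.
exact: sqr_ge0.
Qed.

(** Jensen's inequality for the uniform measure: the tangents are taken at the mean, and their
    linear parts sum to zero. *)
Lemma even_power_mean {R : realFieldType} (K : finType) (y : K -> R) k :
  (0 < #|K|)%N ->
  #|K|%:R * (#|K|%:R^-1 * \sum_i y i) ^+ k.*2 <= \sum_i y i ^+ k.*2.
Proof.
move=> K0; set a := _^-1 * _; set c := k%:R * (a ^+ 2) ^+ k.-1 * (2 * a).
have -> : #|K|%:R * a ^+ k.*2 = \sum_(i : K) (a ^+ k.*2 + c * (y i - a)).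
  rewrite big_split/= -mulr_sumr sumrB !sumr_const mulr_natl.
  rewrite -[a *+ _]mulr_natl /a mulrA divff ?mul1r ?subrr ?mulr0 ?addr0//.
  by rewrite pnatr_eq0 -lt0n.
by apply: ler_sum => i _; exact: even_expr_tangent_le.
Qed.

(** The sets in question are those avoiding [j] minus those avoiding both points,
    [2 ^ (n - 1) - 2 ^ (n - 2)] in number for [n] the cardinal of [I]: a quarter of all sets. *)
Lemma card_separating_sets (I : finType) (i j : I) : i != j ->
  (4 * \sum_(Q : {set I}) ((i \in Q) && (j \notin Q)) = 2 ^ #|I|)%N.
Proof.
move=> ij.
have -> : (\sum_(Q : {set I}) ((i \in Q) && (j \notin Q)) =
    #|powerset (~: [set j]) :\: powerset (~: [set i; j])|)%N.
  rewrite -sum1_card [RHS]big_mkcond; apply: eq_bigr => Q _; rewrite !inE.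
  have sub (B : {set I}) : (Q \subset ~: B) = ~~ [exists l, (l \in Q) && (l \in B)].
    apply/fintype.subsetP/existsPn => QB l.
      by apply/negP => /andP[/QB]; rewrite inE => /negP.
    by move=> lQ; rewrite inE; move: (QB l); rewrite lQ.
  have -> : (Q \subset ~: [set j]) = (j \notin Q).
    rewrite sub; congr (~~ _); apply/existsP/idP => [[l]|jQ].
      by rewrite inE => /andP[+ /eqP <-].
    by exists j; rewrite jQ set11.
  have -> : (Q \subset ~: [set i; j]) = (j \notin Q) && (i \notin Q).
    rewrite sub -negb_or; congr (~~ _); apply/existsP/orP => [[l]|].
      by rewrite !inE => /andP[lQ /orP[]/eqP <-]; [right|left].
    by case=> ?; [exists j|exists i]; rewrite !inE eqxx ?orbT andbT.
  by case: (i \in Q); case: (j \in Q).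
rewrite cardsD (finset.setIidPr _); last first.
  by rewrite powersetS finset.setCS; apply/fintype.subsetP => l; rewrite !inE => ->; rewrite orbT.
rewrite !card_powerset cardsC1 [#|~: _|]cardsCs finset.setCK cards2 ij.
have : (1 < #|I|)%N.
  by have := max_card [set i; j]%SET; rewrite cards2 ij.
case: #|I| => [|[|N]]// _; rewrite subSS subSS subn0/= !expnS; nia.
Qed.

Lemma card_set_type (I : finType) : (#|{set I}| = 2 ^ #|I|)%N.
Proof. by rewrite -[LHS]cardsT -powersetT card_powerset cardsT. Qed.

Section quadratic_form.
Context {R : realType} {T : Type} {I K : finType} (x : I -> T -> R)
  (E : (T -> R) -> R) (efE : expectation_functional x E) (A : K -> I -> R).
Local Notation poly := (polyfun x).
Context (Ex0 : forall i, E (x i) = 0).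

Definition restricted_form (Q : pred I) (r : K) (w : T) :=
  \sum_(i | Q i) A r i * x i w.

Definition restricted_sqnorm (Q : pred I) (w : T) :=
  \sum_r restricted_form Q r w ^+ 2.

Lemma polyfun_form (Q : pred I) r : poly [set i | Q i] (restricted_form Q r).
Proof. by apply: polyfun_sum => i Qi; exact/polyfunZ/polyfun_var. Qed.

Lemma polyfun_sqnorm (Q : pred I) : poly [set i | Q i] (restricted_sqnorm Q).
Proof. by apply: polyfun_sum => r _; exact/polyfunX/polyfun_form. Qed.

Lemma restricted_sqnorm_ge0 Q w : 0 <= restricted_sqnorm Q w.
Proof. by apply: sumr_ge0 => r _; exact: sqr_ge0. Qed.

(* Conditional Jensen: the form restricted to Q is the conditional expectation
   of the full one. *)
Lemma restricted_sqnorm_moment_le (Q : pred I) k :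
  E (fun w => restricted_sqnorm Q w ^+ k) <=
  E (fun w => restricted_sqnorm predT w ^+ k).
Proof.
(* The cross term of the tangent inequality, up to the factor [2 * k]. Each summand is linear in one
   variable outside [Q], with a cofactor in the variables of [Q], so its expectation vanishes. *)
pose L w := \sum_r \sum_(i | ~~ Q i)
  A r i * (x i w * (restricted_form Q r w * restricted_sqnorm Q w ^+ k.-1)).
have pf i r : ~~ Q i ->
    poly (~` [set i]) (fun w => restricted_form Q r w * restricted_sqnorm Q w ^+ k.-1).
  move=> Qi; apply: (@polyfunS _ _ _ _ [set i | Q i]).
    by move=> j /= Qj ji; move: Qi; rewrite -ji Qj.
  by apply: polyfunM; [exact: polyfun_form|exact/polyfunX/polyfun_sqnorm].
have pL' r i : ~~ Q i -> poly setT (fun w => x i w *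
    (restricted_form Q r w * restricted_sqnorm Q w ^+ k.-1)).
  by move=> Qi; apply: polyfunM; [exact: polyfun_varT|exact: polyfunT (pf _ _ Qi)].
have pL : poly setT L.
  by apply: polyfun_sum => r _; apply: polyfun_sum => i Qi; exact/polyfunZ/pL'.
have EL : E L = 0.
  rewrite (ef_sum efE); last first.
    by move=> r _; apply: polyfun_sum => i Qi; exact/polyfunZ/pL'.
  apply: big1 => r _; rewrite (ef_sum efE); last by move=> i Qi; exact/polyfunZ/pL'.
  apply: big1 => i Qi; rewrite (efZ efE); last exact: pL'.
  by rewrite (ef_indep1 efE) ?Ex0 ?mul0r ?mulr0//; exact: pf.
have pQ Q' : poly setT (fun w => restricted_sqnorm Q' w ^+ k).
  exact/polyfunX/polyfunT/polyfun_sqnorm.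
apply: (@le_trans _ _ (E (fun w => (2 * k%:R) * L w + restricted_sqnorm Q w ^+ k))).
  by rewrite (ef_lin efE)// EL mulr0 add0r.
apply: (ef_le efE) => // [|w]; first by apply: polyfunD => //; exact: polyfunZ.
have := expr_tangent_le k (restricted_sqnorm_ge0 Q w) (restricted_sqnorm_ge0 predT w).
apply: le_trans; rewrite addrC lerD2l.
pose v r := \sum_(i | ~~ Q i) A r i * x i w.
have split r : restricted_form predT r w = restricted_form Q r w + v r.
  by rewrite /restricted_form (bigID Q).
have -> : 2 * k%:R * L w = k%:R * (restricted_sqnorm Q w ^+ k.-1 *
    (2 * \sum_r v r * restricted_form Q r w)).
  have -> : L w = restricted_sqnorm Q w ^+ k.-1 *
      \sum_r v r * restricted_form Q r w.
    rewrite mulr_sumr; apply: eq_bigr => r _.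
    by rewrite /v mulr_suml mulr_sumr; apply: eq_bigr => i _; ring.
  by ring.
apply: ler_wpM2l => //; apply: ler_wpM2l.
  by apply: exprn_ge0; exact: restricted_sqnorm_ge0.
(* Row by row, what is dropped is the square of the part of the form outside [Q]. *)
rewrite -sumrB mulr_sumr; apply: ler_sum => r _; rewrite split -subr_ge0.
by have -> : forall a b : R, (a + b) ^+ 2 - a ^+ 2 - 2 * (b * a) = b ^+ 2;
  [move=> a b; ring|exact: sqr_ge0].
Qed.

Definition gram (i j : I) : R := \sum_r A r i * A r j.

(** The coefficients of the linear form are the coordinates in [Q] of the transpose of [A] applied
    to [restricted_form (predC Q)]. The transpose being a contraction, the sum of their squares is
    at most [restricted_sqnorm (predC Q)], whose moments are below those of the full norm. *)
Lemma decoupled_moment (c : R) (k : nat) (Q : pred I) : 0 <= c ->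
  (forall i j, (0 < j <= k)%N ->
     E (fun w => x i w ^+ j.*2) <= c ^+ j * gauss_weight j) ->
  (forall v : K -> R, \sum_i (\sum_r A r i * v r) ^+ 2 <= \sum_r v r ^+ 2) ->
  E (fun w => (\sum_(i | Q i) \sum_(j | ~~ Q j) gram i j * (x i w * x j w)) ^+ k.*2) <=
  (3 * c) ^+ k * gauss_weight k * E (fun w => restricted_sqnorm predT w ^+ k).
Proof.
move=> c0 Exc AT.
pose b i w := \sum_(j | ~~ Q j) gram i j * x j w.
pose s := [seq i <- enum I | Q i].
have ms i : i \in s = Q i by rewrite mem_filter mem_enum andbT.
have us : uniq s by rewrite filter_uniq// enum_uniq.
have bs (F : I -> R) : \sum_(i <- s) F i = \sum_(i | Q i) F i.
  by rewrite /s big_filter big_enum_cond.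
have pb i : poly [set j | ~~ Q j] (b i).
  by apply: polyfun_sum => j Qj; exact/polyfunZ/polyfun_var.
have -> : (fun w => (\sum_(i | Q i) \sum_(j | ~~ Q j)
    gram i j * (x i w * x j w)) ^+ k.*2) =
    (fun w => 1 * (\sum_(i <- s) x i w * b i w) ^+ k.*2).
  apply/funext => w; rewrite mul1r bs; congr (_ ^+ _); apply: eq_bigr => i _.
  by rewrite mulr_sumr; apply: eq_bigr => j _; ring.
apply: (le_trans (linear_form_moment efE (k := k) (J := [set j | ~~ Q j])
   (h := fun=> 1) c0 _ _ us _ _ _ _ _)) => //.
- by move=> i j _; exact: Exc.
- by move=> i; rewrite ms /= => ->.
- exact: polyfun_cst.
apply: ler_wpM2l.
  by apply: mulr_ge0; [apply: exprn_ge0; exact: mulr_ge0|exact: gauss_weight_ge0].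
apply: le_trans (restricted_sqnorm_moment_le (predC Q) k).
apply: (ef_le efE) => [||w].
- apply: polyfunM; first exact: polyfun_cst.
  apply: polyfunX; apply: polyfun_sum => i _; apply: polyfunX.
  exact: polyfunT (pb i).
- exact/polyfunX/polyfunT/polyfun_sqnorm.
have h0 : 0 <= \sum_(i <- s) b i w ^+ 2 by apply: sumr_ge0 => i _; exact: sqr_ge0.
rewrite mul1r lerXn2r// ?nnegrE ?restricted_sqnorm_ge0//.
apply: le_trans (AT (fun r => restricted_form (predC Q) r w)).
(* The contraction bounds the sum over all coordinates; those outside [Q] are discarded. *)
rewrite bs [leRHS](bigID Q)/= -[leLHS]addr0; apply: lerD; last first.
  by apply: sumr_ge0 => i _; exact: sqr_ge0.
rewrite le_eqVlt; apply/orP; left; apply/eqP; apply: eq_bigr => i _.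
congr (_ ^+ 2); rewrite /b /gram.
rewrite (eq_bigr (fun j => \sum_r A r i * A r j * x j w)); last first.
  by move=> j _; rewrite mulr_suml.
rewrite exchange_big/=; apply: eq_bigr => r _.
by rewrite /restricted_form mulr_sumr; apply: eq_bigr => j _; rewrite mulrA.
Qed.

Definition off_diagonal (w : T) :=
  \sum_i \sum_(j | i != j) gram i j * (x i w * x j w).

(** A quarter of the sets separate a given ordered pair of distinct indices, and none separates an
    index from itself, so averaging removes the diagonal. *)
Lemma off_diagonal_decoupling w : off_diagonal w =
  4 * (#|{set I}|%:R^-1 * \sum_(Q : {set I}) \sum_(i in Q) \sum_(j | j \notin Q)
         gram i j * (x i w * x j w)).
Proof.
have -> : \sum_(Q : {set I}) \sum_(i in Q) \sum_(j | j \notin Q)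
         gram i j * (x i w * x j w) =
   \sum_i \sum_j (\sum_(Q : {set I}) ((i \in Q) && (j \notin Q)))%N%:R *
     (gram i j * (x i w * x j w)).
  transitivity (\sum_(Q : {set I}) \sum_i \sum_j
      ((i \in Q) && (j \notin Q))%:R * (gram i j * (x i w * x j w))).
    apply: eq_bigr => Q _; rewrite big_mkcond/=; apply: eq_bigr => i _.
    case: (i \in Q) => /=; last by rewrite big1// => j _; rewrite mul0r.
    rewrite big_mkcond/=; apply: eq_bigr => j _.
    by case: (j \in Q) => /=; rewrite ?mul0r ?mul1r.
  rewrite exchange_big/=; apply: eq_bigr => i _.
  rewrite exchange_big/=; apply: eq_bigr => j _.
  by rewrite -mulr_suml natr_sum.
have N0 : 2 ^+ #|I| != 0 :> R by rewrite expf_neq0// pnatr_eq0.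
rewrite card_set_type natrX mulrA mulr_sumr; apply: eq_bigr => i _.
rewrite mulr_sumr big_mkcond/=; apply: eq_bigr => j _.
case: eqVneq => [->|ij]/=.
  by rewrite big1 ?mul0r ?mulr0// => Q _; rewrite andbN.
set g := gram i j * _; rewrite [RHS]mulrA -[LHS]mul1r; congr (_ * _).
by rewrite mulrAC -(@natrM R 4) card_separating_sets// natrX divff.
Qed.

(** Jensen's inequality for the average over [Q], then the bound for each [Q]. Here 48 is [4 ^ 2]
    from the decoupling times 3 from the linear form. *)
Lemma off_diagonal_moment (c : R) (k : nat) : 0 <= c ->
  (forall i j, (0 < j <= k)%N ->
     E (fun w => x i w ^+ j.*2) <= c ^+ j * gauss_weight j) ->
  (forall v : K -> R, \sum_i (\sum_r A r i * v r) ^+ 2 <= \sum_r v r ^+ 2) ->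
  E (fun w => off_diagonal w ^+ k.*2) <=
  (48 * c) ^+ k * gauss_weight k * E (fun w => restricted_sqnorm predT w ^+ k).
Proof.
move=> c0 Exc AT.
pose S (Q : {set I}) w := \sum_(i in Q) \sum_(j | j \notin Q)
         gram i j * (x i w * x j w).
have pS Q : poly setT (S Q).
  apply: polyfun_sum => i _; apply: polyfun_sum => j _; apply: polyfunZ.
  by auto with polyfun.
have N0 : (0 < #|{set I}|)%N by rewrite card_set_type expn_gt0.
set N := #|{set I}| in N0 *.
have N0' : 0 < N%:R :> R by rewrite ltr0n.
apply: (@le_trans _ _ (E (fun w => (16 ^+ k * N%:R^-1) * \sum_Q S Q w ^+ k.*2))).
  apply: (ef_le efE) => [||w].
  - apply/polyfunX/polyfun_sum => i _; apply: polyfun_sum => j _.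
    by apply: polyfunZ; auto with polyfun.
  - by apply/polyfunZ/polyfun_sum => Q _; exact/polyfunX.
  rewrite off_diagonal_decoupling exprMn.
  have -> : 4 ^+ k.*2 = 16 ^+ k :> R by rewrite -mul2n exprM; congr (_ ^+ _); ring.
  rewrite -mulrA; apply: ler_wpM2l; first exact: exprn_ge0.
  by rewrite -/N [leRHS]mulrC ler_pdivlMr// mulrC; exact: even_power_mean.
rewrite (efZ efE); last by apply: polyfun_sum => Q _; exact/polyfunX.
rewrite (ef_sum efE); last by move=> Q _; exact/polyfunX.
set M := (3 * c) ^+ k * gauss_weight k * E (fun w => restricted_sqnorm predT w ^+ k).
have -> : (48 * c) ^+ k * gauss_weight k *
    E (fun w => restricted_sqnorm predT w ^+ k) = 16 ^+ k * N%:R^-1 * (N%:R * M).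
  rewrite [RHS]mulrA mulfVK ?gt_eqF// /M (_ : 48 * c = 16 * (3 * c)); last by ring.
  by rewrite (exprMn k 16) !mulrA.
apply: ler_wpM2l; first by rewrite mulr_ge0 ?exprn_ge0 ?invr_ge0.
rewrite mulr_natl -sumr_const; apply: ler_sum => Q _.
exact: (decoupled_moment (fun i => i \in Q)).
Qed.

(** Testing the contraction on column [i] and keeping only coordinate [i] of the result gives
    [g ^+ 2 <= g] for [g = gram i i]. *)
Lemma gram_diag_le1 i :
  (forall v : K -> R, \sum_i (\sum_r A r i * v r) ^+ 2 <= \sum_r v r ^+ 2) ->
  0 <= gram i i <= 1.
Proof.
move=> AT; have g0 : 0 <= gram i i.
  by apply: sumr_ge0 => r _; rewrite -expr2 sqr_ge0.
rewrite g0 /=; have := AT (fun r => A r i).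
have -> : \sum_r A r i ^+ 2 = gram i i by [].
rewrite (bigD1 i)//= -/(gram i i) => h.
have : gram i i ^+ 2 <= gram i i.
  by apply: le_trans h; rewrite lerDl sumr_ge0// => j _; exact: sqr_ge0.
rewrite leNgt => h1; rewrite leNgt; apply/negP => g1; move/negP: h1; apply.
by rewrite expr2 ltr_pMl// (lt_trans _ g1).
Qed.

Lemma restricted_sqnormE w : restricted_sqnorm predT w =
  \sum_i gram i i * x i w ^+ 2 + off_diagonal w.
Proof.
rewrite /off_diagonal -big_split/= /restricted_sqnorm.
transitivity (\sum_i \sum_j gram i j * (x i w * x j w)).
  transitivity (\sum_r \sum_i \sum_j (A r i * A r j) * (x i w * x j w)).
    apply: eq_bigr => r _; rewrite /restricted_form expr2 mulr_suml.
    apply: eq_bigr => i _; rewrite mulr_sumr; apply: eq_bigr => j _; ring.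
  rewrite exchange_big/=; apply: eq_bigr => i _.
  by rewrite exchange_big/=; apply: eq_bigr => j _; rewrite mulr_suml.
apply: eq_bigr => i _; rewrite (bigD1 i)//= expr2; congr (_ + _).
by apply: eq_bigl => j; rewrite eq_sym.
Qed.

End quadratic_form.

Section real_powers_of_sums.
Context {R : realFieldType}.
Implicit Types a b c : R.

Lemma exprD_superadditive a b k : 0 <= a -> 0 <= b -> (0 < k)%N ->
  a ^+ k + b ^+ k <= (a + b) ^+ k.
Proof.
move=> a0 b0; case: k => // k _; rewrite !exprS mulrDl; apply: lerD.
  by apply: ler_wpM2l => //; rewrite lerXn2r ?nnegrE ?addr_ge0// lerDl.
by apply: ler_wpM2l => //; rewrite lerXn2r ?nnegrE ?addr_ge0// lerDr.
Qed.

Lemma even_exprD2_le a b k :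
  (a + b) ^+ k.*2 <= 4 ^+ k * (a ^+ k.*2 + b ^+ k.*2).
Proof.
have := even_power_mean (fun i : 'I_2 => if i == ord0 then a else b) k.
rewrite card_ord !big_ord_recr !big_ord0/= !add0r => /(_ isT).
rewrite exprMn exprVn => h.
have -> : 4 ^+ k = 2 ^+ k.*2 :> R by rewrite -mul2n exprM; congr (_ ^+ _); ring.
rewrite mulrC -ler_pdivrMr ?exprn_gt0// mulrC; apply: le_trans h.
have h0 : 0 <= (2 ^+ k.*2)^-1 * (a + b) ^+ k.*2.
  apply: mulr_ge0; first by rewrite invr_ge0 exprn_ge0.
  by apply: exprn_even_ge0; rewrite odd_double.
by rewrite ler_peMl// ler1n.
Qed.

Lemma even_exprD3_le a b c k :
  (a + b + c) ^+ k.*2 <= 9 ^+ k * (a ^+ k.*2 + b ^+ k.*2 + c ^+ k.*2).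
Proof.
have := even_power_mean (fun i : 'I_3 => if i == 0%N :> nat then a
  else if i == 1%N :> nat then b else c) k.
rewrite card_ord !big_ord_recr !big_ord0/= !add0r => /(_ isT).
rewrite exprMn exprVn => h.
have -> : 9 ^+ k = 3 ^+ k.*2 :> R by rewrite -mul2n exprM; congr (_ ^+ _); ring.
rewrite mulrC -ler_pdivrMr ?exprn_gt0// mulrC; apply: le_trans h.
have h0 : 0 <= (3 ^+ k.*2)^-1 * (a + b + c) ^+ k.*2.
  apply: mulr_ge0; first by rewrite invr_ge0 exprn_ge0.
  by apply: exprn_even_ge0; rewrite odd_double.
by rewrite ler_peMl// ler1n.
Qed.

Lemma fact_le_expn n : (n`! <= n ^ n)%N.
Proof.
elim: n => // n IH; rewrite factS expnS leq_mul2l (leq_trans IH)//.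
by case: n {IH} => // n; rewrite leq_exp2r.
Qed.

(** The quotient of factorials is a product of [k] factors, each at most [2 * k]. *)
Lemma gauss_weight_le (k : nat) : gauss_weight k <= (2 * k%:R) ^+ k :> R.
Proof.
rewrite /gauss_weight ler_pdivrMr ?ltr0n ?fact_gt0//.
rewrite -natrM -natrX -natrM ler_nat.
have h j : (j <= k)%N -> ((k + j)`! <= (2 * k) ^ j * k`!)%N.
  elim: j => [_|j IH jk]; first by rewrite addn0 expn0 mul1n.
  have e : ((k + j.+1)`! = (k + j).+1 * (k + j)`!)%N by rewrite addnS factS.
  have le : ((k + j).+1 <= 2 * k)%N by rewrite mul2n -addnn -addnS leq_add2l.
  have -> : ((2 * k) ^ j.+1 * k`! = (2 * k) * ((2 * k) ^ j * k`!))%N.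
    by rewrite expnS mulnA.
  by rewrite e; exact: leq_mul le (IH (ltnW jk)).
by rewrite -addnn; exact: h.
Qed.

End real_powers_of_sums.

Ltac nonneg :=
  lazymatch goal with
  | |- is_true (0 <= _ ^+ _) => apply: exprn_ge0; nonneg
  | |- is_true (0 <= _ * _) => apply: mulr_ge0; nonneg
  | |- is_true (0 <= _ + _) => apply: addr_ge0; nonneg
  | |- is_true (0 <= _^-1) => rewrite invr_ge0; nonneg
  | |- is_true (0 <= expR _) => exact: expR_ge0
  | |- is_true (0 <= _%:R) => exact: ler0n
  | |- is_true (_ \is Num.nneg) => rewrite nnegrE; nonneg
  | |- is_true (_ \in Num.nneg) => rewrite nnegrE; nonneg
  | |- _ => first [ by [] | by apply: ltW ]
  end.

(** * The central moment of the squared norm *)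

Section quadratic_form_moment.
Context {R : realType}.

(** The factor 8 combines [(2k)! <= (4 * k ^ 2) ^ k] with the 2 in the choice of [zi], and [expR 12]
    is the exponential at that choice. Below, 9 is the cost of splitting into three parts, which
    becomes 18 and 81 when the quadratic inequality is solved; [96 = 48 * 2] comes from the
    off-diagonal part, and the 4 of [moment_const] from splitting into two parts. *)
Definition diag_const (C : R) := 8 * expR 12 * C ^+ 2.
Definition sqnorm_const (C : R) :=
  18 + 18 * diag_const C + 81 * 96 ^+ 2 * C ^+ 2.
Definition moment_const (C : R) :=
  4 * (diag_const C + 96 * C * sqnorm_const C).

Context {T : Type} {I K : finType} (x : I -> T -> R)
  (E : (T -> R) -> R) (efE : expectation_functional x E) (A : K -> I -> R).
Local Notation poly := (polyfun x).
Context (p C l kappa : R) (k : nat).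
Context (p0 : 0 <= p) (p1 : p <= 1) (C1 : 1 <= C) (l1 : 1 <= l)
  (kappa1 : 1 <= kappa) (k0 : (0 < k)%N).
Context (Ex0 : forall i, E (x i) = 0)
  (Ex2 : forall i, E (fun w => x i w ^+ 2) = p).
Context (ExK : forall i j, (0 < j <= k)%N ->
  E (fun w => x i w ^+ j.*2) <= (C * l ^+ 2 * kappa) ^+ j * gauss_weight j).
(** Unlike [ExK], this bound keeps the factor [p], so that the variance of the diagonal part is
    controlled by [p * F2]; its leading constant [C * l ^+ 4] is also free of [kappa]. *)
Context (ExV : forall i j, (j < k)%N ->
  E (fun w => (x i w ^+ 2) ^+ j.+1.*2) <=
  p * (C * l ^+ 4) * ((C * l ^+ 2 * kappa) ^+ 2) ^+ j * (j.+1.*2)`!%:R).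
Context (AT : forall v : K -> R,
  \sum_i (\sum_r A r i * v r) ^+ 2 <= \sum_r v r ^+ 2).

Let F2 := \sum_i gram A i i.
(** The square of the deviation scale: [kappa] stands for [k ^ (2 / alpha - 1)], so [k * kappa] is
    [k ^ (2 / alpha)]. *)
Let tau2 := l ^+ 4 * (k%:R * kappa).
Let X := restricted_sqnorm x A predT.
Let D w := \sum_i gram A i i * (x i w ^+ 2 - p).
Let O := off_diagonal x A.

Let gram01 i : 0 <= gram A i i <= 1. Proof. exact: gram_diag_le1. Qed.
Let F20 : 0 <= F2.
Proof. by apply: sumr_ge0 => i _; have /andP[] := gram01 i. Qed.
Let C0 : 0 < C. Proof. exact: lt_le_trans C1. Qed.
Let l0 : 0 < l. Proof. exact: lt_le_trans l1. Qed.
Let kappa0 : 0 < kappa. Proof. exact: lt_le_trans kappa1. Qed.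
Let s0 : 0 <= k%:R * kappa. Proof. by nonneg. Qed.
Let kR1 : 1 <= k%:R :> R. Proof. by rewrite ler1n. Qed.
Let tau_ge : k%:R * kappa <= tau2.
Proof. by rewrite ler_peMl// exprn_ege1. Qed.
Let tau1 : 1 <= tau2.
Proof. by rewrite (le_trans _ tau_ge)// -[leLHS]mulr1 ler_pM. Qed.
Let tau0 : 0 <= tau2. Proof. exact: le_trans tau1. Qed.
Let U0 : 0 <= p * F2 + tau2. Proof. by nonneg. Qed.
Let dc0 : 0 <= diag_const C. Proof. by rewrite /diag_const; nonneg. Qed.
Let sc0 : 0 <= sqnorm_const C. Proof. by rewrite /sqnorm_const; nonneg. Qed.
Let XE w : X w = p * F2 + D w + O w.
Proof.
rewrite /X restricted_sqnormE; congr (_ + _); rewrite mulr_sumr -big_split/=.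
by apply: eq_bigr => i _; ring.
Qed.
Let pX : poly setT X. Proof. exact/polyfunT/polyfun_sqnorm. Qed.
Let pD : poly setT D.
Proof. by apply: polyfun_sum => i _; apply: polyfunZ; auto with polyfun. Qed.
Let pO : poly setT O.
Proof.
apply: polyfun_sum => i _; apply: polyfun_sum => j _; apply: polyfunZ.
by auto with polyfun.
Qed.

Let D_moment : E (fun w => D w ^+ k.*2) <=
  (diag_const C * (tau2 * (p * F2 + tau2))) ^+ k.
Proof.
pose V := C * l ^+ 4; pose S := C * l ^+ 2 * kappa.
have V1 : 1 <= V by rewrite -[leLHS]mulr1 ler_pM// exprn_ege1.
have S1 : 1 <= S.
  by rewrite -[leLHS]mulr1 ler_pM// -[leLHS]mulr1 ler_pM// exprn_ege1.
have kR0 : 0 < k%:R :> R by rewrite ltr0n.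
(* The inverse of [z]. Its first term ensures [S ^+ 2 * z <= 1/2]; its second makes the exponent at
   most [12 * k], a constant factor per power. *)
pose zi := 2 * S ^+ 2 + p * V * F2 / k%:R.
have V0 : 0 <= V by rewrite (le_trans _ V1).
have S0 : 0 < S by exact: lt_le_trans S1.
have pVF : 0 <= p * V * F2 / k%:R by nonneg.
have S20 : 0 < S ^+ 2 by rewrite exprn_gt0.
have zi0 : 0 < zi by rewrite ltr_wpDr// mulr_gt0.
have Sz : S ^+ 2 * zi^-1 <= 2^-1.
  rewrite ler_pdivrMr// /zi mulrDr mulrA mulVf// mul1r lerDl.
  by nonneg.
have := centred_squares_moment efE (c := fun i => gram A i i) (s := enum I)
  p0 p1 V1 S1 (z := zi^-1) _ Sz _ _ _ (enum_uniq _) (leqnn k).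
rewrite invr_gt0 zi0 => /(_ isT) /(_ (fun i _ => gram01 i)) /(_ (fun i _ => Ex2 i)).
move=> /(_ (fun i j _ => @ExV i j)).
under eq_fun do rewrite big_enum.
rewrite big_enum -/F2 invrK => /le_trans; apply.
have hexp : expR (12 * p * V * zi^-1 * F2) <= expR 12 ^+ k.
  have -> : 12 * p * V * zi^-1 * F2 = 12 * (p * V * F2 * zi^-1) by ring.
  rewrite -expRM_natr ler_expR; apply: ler_wpM2l => //; rewrite ler_pdivrMr//.
  by rewrite /zi mulrDr [X in _ + X]mulrC divfK ?gt_eqF// lerDr; nonneg.
apply: (@le_trans _ _ ((4 * k%:R ^+ 2) ^+ k * zi ^+ k * expR 12 ^+ k)).
  apply: ler_pM; [by nonneg|by nonneg| |by []].
  apply: ler_wpM2r; first by nonneg.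
  have -> : 4 * k%:R ^+ 2 = (k.*2)%:R ^+ 2 :> R.
    by rewrite -muln2 natrM; ring.
  by rewrite -exprM mul2n -natrX ler_nat fact_le_expn.
rewrite -!exprMn lerXn2r// ?nnegrE.
- by nonneg.
- by nonneg.
have -> : 4 * k%:R ^+ 2 * zi * expR 12 =
   (8 * expR 12) * (k%:R ^+ 2 * S ^+ 2 + 2^-1 * (k%:R * (p * V * F2))).
  by rewrite /zi; field; rewrite gt_eqF.
rewrite /diag_const -[leRHS]mulrA; apply: ler_wpM2l; first by nonneg.
rewrite mulrDr mulrDr addrC; apply: lerD.
  (* The variance term, through [V], uses the full power [l ^+ 4] in [tau2]. *)
  apply: (@le_trans _ _ (k%:R * (p * V * F2))).
    by rewrite ler_piMl ?invf_le1 ?ler1n//; nonneg.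
  have -> : k%:R * (p * V * F2) = C * (l ^+ 4 * k%:R) * (p * F2).
    by rewrite /V; ring.
  rewrite [leRHS]mulrA; apply: ler_wpM2r; first exact: mulr_ge0.
  apply: ler_pM.
  - by nonneg.
  - by nonneg.
  - by rewrite expr2 ler_peMl// ltW.
  - by rewrite /tau2; apply: ler_wpM2l; [nonneg|rewrite ler_peMr].
have -> : k%:R ^+ 2 * S ^+ 2 = C ^+ 2 * (tau2 * (k%:R * kappa)).
  by rewrite /S /tau2; ring.
by apply: ler_wpM2l; [nonneg|exact: ler_wpM2l].
Qed.

Let O_moment : E (fun w => O w ^+ k.*2) <=
  (96 * C * (l ^+ 2 * (k%:R * kappa))) ^+ k * E (fun w => X w ^+ k).
Proof.
have c0 : 0 <= C * l ^+ 2 * kappa by nonneg.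
apply: (le_trans (off_diagonal_moment efE Ex0 c0 ExK AT)).
apply: ler_wpM2r.
  apply: (ef_ge0 efE) => [|w]; first exact: polyfunX.
  by apply: exprn_ge0; exact: restricted_sqnorm_ge0.
apply: (@le_trans _ _ ((48 * (C * l ^+ 2 * kappa)) ^+ k * (2 * k%:R) ^+ k)).
  by apply: ler_wpM2l; [nonneg|exact: gauss_weight_le].
rewrite -exprMn le_eqVlt; apply/orP; left; apply/eqP; congr (_ ^+ _); ring.
Qed.

(* Self-bounding: [O_moment] bounds the off-diagonal part by a moment of X
   itself, of half the order, so the inequality can be solved for that moment. *)
Let X_moment : E (fun w => X w ^+ k) <= (sqnorm_const C * (p * F2 + tau2)) ^+ k.
Proof.
set m := E _; set U := p * F2 + tau2.
have pF0 : 0 <= p * F2 by exact: mulr_ge0.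
set G := 96 * C * (l ^+ 2 * (k%:R * kappa)).
have G0 : 0 <= G by rewrite /G; nonneg.
have m0 : 0 <= m.
  apply: (ef_ge0 efE) => [|w]; first exact: polyfunX.
  by apply: exprn_ge0; exact: restricted_sqnorm_ge0.
have h1 : m ^+ 2 <= 9 ^+ k * ((p * F2) ^+ k.*2 +
    (diag_const C * (tau2 * U)) ^+ k + G ^+ k * m).
  apply: (le_trans (ef_sqr_le efE (polyfunX k pX))).
  apply: (@le_trans _ _ (E (fun w => 9 ^+ k * ((p * F2) ^+ k.*2 + D w ^+ k.*2
     + O w ^+ k.*2)))).
    apply: (ef_le efE) => [||w].
    - exact/polyfunX/polyfunX.
    - by apply: polyfunZ; auto with polyfun.
    - by rewrite -exprM muln2 XE; exact: even_exprD3_le.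
  rewrite (efZ efE); last by auto with polyfun.
  apply: ler_wpM2l; first exact: exprn_ge0.
  rewrite (efD efE) ?(efD efE) ?(ef_cst efE); [|by auto with polyfun..].
  by apply: lerD; [apply: lerD|].
have h2 : m ^+ 2 <= 18 ^+ k * (U ^+ 2) ^+ k +
   18 ^+ k * (diag_const C * U ^+ 2) ^+ k + (81 * G ^+ 2) ^+ k.
  (* After doubling [h1], this lets the term linear in [m] be absorbed by one of the two copies of
     [m ^+ 2]. *)
  have amgm : 2 * (9 ^+ k * (G ^+ k * m)) <= m ^+ 2 + (81 * G ^+ 2) ^+ k.
    have -> : (81 * G ^+ 2) ^+ k = (9 ^+ k * G ^+ k) ^+ 2.
      by rewrite -exprMn -!exprM mulnC exprM; congr (_ ^+ _); ring.
    rewrite -subr_ge0.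
    have := sqr_ge0 (m - 9 ^+ k * G ^+ k).
    by rewrite sqrrB; congr (0 <= _); ring.
  have e18 : 2 * 9 ^+ k <= 18 ^+ k :> R.
    have -> : 18 = 2 * 9 :> R by ring.
    rewrite exprMn; apply: ler_wpM2r; first exact: exprn_ge0.
    by rewrite -{1}(expr1 2) ler_weXn2l// ler1n.
  have b1 : 2 * 9 ^+ k * (p * F2) ^+ k.*2 <= 18 ^+ k * (U ^+ 2) ^+ k.
    apply: ler_pM; [by nonneg|by nonneg|exact: e18|].
    by rewrite -exprM mul2n; apply: lerXn2r; [nonneg|nonneg|rewrite lerDl].
  have b2 : 2 * 9 ^+ k * (diag_const C * (tau2 * U)) ^+ k <=
      18 ^+ k * (diag_const C * U ^+ 2) ^+ k.
    apply: ler_pM; [by nonneg|by nonneg|exact: e18|].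
    apply: lerXn2r; [by nonneg|by nonneg|].
    by apply: ler_wpM2l => //; rewrite expr2; apply: ler_wpM2r => //; rewrite lerDr.
  move: h1 amgm b1 b2; rewrite -!(mulrA 2) !(mulrDr (9 ^+ k)).
  move: (9 ^+ k * (p * F2) ^+ k.*2) (9 ^+ k * (_ * (_ * _)) ^+ k)
    (9 ^+ k * (_ * m)) (18 ^+ k * _ ^+ k) (18 ^+ k * _ ^+ k)
    ((81 * _) ^+ k) => *; lra.
have G2 : 81 * G ^+ 2 <= (81 * 96 ^+ 2 * C ^+ 2) * U ^+ 2.
  have -> : 81 * G ^+ 2 = (81 * 96 ^+ 2 * C ^+ 2) * (tau2 * (k%:R * kappa)).
    by rewrite /G /tau2; ring.
  apply: ler_wpM2l; first by nonneg.
  rewrite expr2; apply: ler_pM => //; rewrite /U ?lerDr//.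
  by rewrite (le_trans tau_ge)// lerDr.
have h3 : m ^+ 2 <= (sqnorm_const C * U ^+ 2) ^+ k.
  apply: (le_trans h2); rewrite -!exprMn.
  have -> : sqnorm_const C * U ^+ 2 = (18 * U ^+ 2 + 18 * diag_const C * U ^+ 2) +
      81 * 96 ^+ 2 * C ^+ 2 * U ^+ 2 by rewrite /sqnorm_const; ring.
  have U20 : 0 <= U ^+ 2 by exact: exprn_ge0.
  apply: (@le_trans _ _ ((18 * U ^+ 2 + 18 * diag_const C * U ^+ 2) ^+ k +
    (81 * 96 ^+ 2 * C ^+ 2 * U ^+ 2) ^+ k)); last first.
    by apply: exprD_superadditive => //; nonneg.
  apply: lerD.
    rewrite [18 * (diag_const C * _)]mulrA.
    by apply: exprD_superadditive => //; nonneg.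
  by apply: lerXn2r; rewrite // nnegrE; nonneg.
have sc1 : 1 <= sqnorm_const C.
  rewrite /sqnorm_const -addrA -[leLHS]addr0; apply: lerD; first by rewrite ler1n.
  by nonneg.
rewrite -(@ler_pXn2r _ 2)// ?nnegrE; [|by nonneg].
apply: (le_trans h3); rewrite -exprM mulnC exprM.
apply: lerXn2r; [by nonneg|by nonneg|].
by rewrite exprMn; apply: ler_wpM2r; [nonneg|rewrite expr2 ler_peMl].
Qed.

Lemma quadratic_form_moment :
  E (fun w => (X w - p * F2) ^+ k.*2) <=
  (moment_const C * (tau2 * (p * F2 + tau2))) ^+ k.
Proof.
apply: (@le_trans _ _ (E (fun w => 4 ^+ k * (D w ^+ k.*2 + O w ^+ k.*2)))).
  apply: (ef_le efE) => [||w].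
  - by apply/polyfunX/polyfunB => //; exact: polyfun_cst.
  - by apply: polyfunZ; auto with polyfun.
  - have -> : X w - p * F2 = D w + O w by rewrite XE; ring.
    exact: even_exprD2_le.
rewrite (efZ efE); last by auto with polyfun.
rewrite (efD efE); [|by auto with polyfun..].
rewrite /moment_const -[4 * _ * _]mulrA (exprMn k 4).
apply: ler_wpM2l; first exact: exprn_ge0.
rewrite mulrDl; set Q := tau2 * _.
have Q0 : 0 <= Q by exact: mulr_ge0.
apply: le_trans (exprD_superadditive _ _ k0); [|by nonneg|by nonneg].
apply: lerD; first exact: D_moment.
apply: (le_trans O_moment).
apply: (@le_trans _ _ ((96 * C * tau2) ^+ k * (sqnorm_const C * (p * F2 + tau2)) ^+ k)).
  apply: ler_pM.
  - by nonneg.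
  - apply: (ef_ge0 efE) => [|w]; first exact: polyfunX.
    by apply: exprn_ge0; exact: restricted_sqnorm_ge0.
  - apply: lerXn2r; [by nonneg|by nonneg|].
    apply: ler_wpM2l; first by nonneg.
    by apply: ler_wpM2r => //; apply: ler_weXn2l.
  - exact: X_moment.
by rewrite -exprMn le_eqVlt; apply/orP; left; apply/eqP; congr (_ ^+ _); rewrite /Q; ring.
Qed.

End quadratic_form_moment.

(** * Expectations of products of independent variables *)

Section independence.
Context d {T : measurableType d} {R : realType} (P : probability T R).
Local Open Scope ereal_scope.
Import HBNNSimple.

(** The usual passage from indicators to simple functions to monotone limits, with a fixed weight
    [W]. The weight will be the product of all other factors, so that one indicator at a time can be
    replaced by a general function. *)
Lemma ge0_integral_weighted_indep (W X : T -> R) (c : R) :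
  measurable_fun setT W -> (forall w, 0 <= W w)%R ->
  measurable_fun setT X -> (0 <= c)%R ->
  (forall B, measurable B ->
     \int[P]_w (W w * \1_B (X w))%:E = c%:E * P (X @^-1` B)) ->
  forall f : R -> R, measurable_fun setT f -> (forall r, 0 <= f r)%R ->
  \int[P]_w (W w * f (X w))%:E = c%:E * \int[P]_w (f (X w))%:E.
Proof.
move=> mW W0 mX c0 indic f mf f0.
have mfX (g : R -> R) : measurable_fun setT g ->
    measurable_fun [set: T] (EFin \o (g \o X)).
  by move=> mg; apply/measurable_EFinP; exact: measurableT_comp mg mX.
have mWfX (g : R -> R) : measurable_fun setT g ->
    measurable_fun [set: T] (EFin \o (fun w => W w * g (X w))%R).
  move=> mg; apply/measurable_EFinP; apply: measurable_funM => //.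
  exact: measurableT_comp mg mX.
have simple (g : {nnsfun R >-> R}) :
    \int[P]_w (W w * g (X w))%:E = c%:E * \int[P]_w (g (X w))%:E.
  pose s : seq R := finmap.enum_fset (fset_set (range g)).
  have gE r : g r = (\sum_(k <- s) k * \1_(g @^-1` [set k]) r)%R.
    by rewrite fimfunE fsbig_finite.
  have kind k r : (0 <= k * \1_(g @^-1` [set k]) r)%R.
    by have := nnfun_muleindic_ge0 g k r; rewrite -EFinM lee_fin.
  have mg k : measurable (g @^-1` [set k]) by exact: measurable_sfunP.
  have m1 k : measurable_fun setT (fun r : R => \1_(g @^-1` [set k]) r : R).
    exact: measurable_indic.
  have mk k : measurable_fun setT (fun r : R => k * \1_(g @^-1` [set k]) r)%R.
    by apply: measurable_funM => //; exact: measurable_indic.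
  under eq_integral do rewrite gE mulr_sumr -sumEFin.
  rewrite ge0_integral_sum//; last 2 first.
  - by move=> k; exact: (mWfX (fun r => k * \1_(g @^-1` [set k]) r)%R).
  - by move=> k w _; rewrite lee_fin mulr_ge0.
  under [in RHS]eq_integral do rewrite gE -sumEFin.
  rewrite [in RHS]ge0_integral_sum//; last 2 first.
  - by move=> k; exact: (mfX (fun r => k * \1_(g @^-1` [set k]) r)%R).
  - by move=> k w _; rewrite lee_fin.
  rewrite ge0_sume_distrr; last first.
    by move=> k _; apply: integral_ge0 => w _; rewrite lee_fin.
  apply: eq_bigr => k _.
  (* The scalar has to be nonnegative to leave the integral; a negative [k] is not a value of [g],
     and its term is zero. *)
  have [k0|k0] := leP 0%R k; last first.
    have -> : \1_(g @^-1` [set k]) = (cst 0%R : R -> R).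
      by rewrite preimage_nnfun0// indic0.
    under eq_integral do rewrite /= mulr0 mulr0.
    under [in RHS]eq_integral do rewrite /= mulr0.
    by rewrite !integral0 mule0.
  rewrite (eq_integral (fun w => k%:E * (W w * \1_(g @^-1` [set k]) (X w))%:E)); last first.
    by move=> w _; rewrite -EFinM mulrCA.
  rewrite ge0_integralZl//; last 2 first.
  - apply/measurable_EFinP; apply: measurable_funM => //.
    exact: measurableT_comp (m1 k) mX.
  - by move=> w _; rewrite lee_fin mulr_ge0// indicE.
  under [in RHS]eq_integral do rewrite EFinM.
  rewrite ge0_integralZl//; last first.
    by apply/measurable_EFinP; exact: measurableT_comp (m1 k) mX.
  rewrite muleCA indic//; congr (_ * (_ * _)).
  have mXk : measurable (X @^-1` (g @^-1` [set k])).
    by rewrite -[X in measurable X]setTI; exact: mX.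
  by rewrite -[in LHS](setIT (X @^-1` _)) -integral_indic.
have mEf : measurable_fun setT (EFin \o f) by exact/measurable_EFinP.
pose g := nnsfun_approx measurableT mEf.
have cvg_g r : (EFin \o g^~ r) n @[n --> \oo] --> (f r)%:E.
  by apply: (cvg_nnsfun_approx measurableT mEf) => // r' _; rewrite lee_fin.
have nd_g r : {homo g^~ r : m n / (m <= n)%N >-> (m <= n)%R}.
  by move=> m n mn; exact/lefP/nd_nnsfun_approx.
have mg n : measurable_fun setT (g n) by exact: measurable_funP.
have lhs : \int[P]_w (W w * g n (X w))%:E @[n --> \oo] -->
    \int[P]_w (W w * f (X w))%:E.
  have := @cvg_monotone_convergence _ _ _ P _ measurableT
    (fun n w => (W w * g n (X w))%:E).
  rewrite (_ : \int[P]_w limn _ = \int[P]_w (W w * f (X w))%:E); last first.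
    apply: eq_integral => w _; apply/cvg_lim => //.
    under eq_fun do rewrite EFinM.
    by rewrite EFinM; apply: cvgeZl => //; exact: cvg_g.
  apply.
  - by move=> n; exact: mWfX.
  - by move=> n w _; rewrite lee_fin mulr_ge0.
  - by move=> w _ m n mn; rewrite lee_fin ler_wpM2l//; exact: nd_g.
have rhs : \int[P]_w (g n (X w))%:E @[n --> \oo] --> \int[P]_w (f (X w))%:E.
  have := @cvg_monotone_convergence _ _ _ P _ measurableT
    (fun n w => (g n (X w))%:E).
  rewrite (_ : \int[P]_w limn _ = \int[P]_w (f (X w))%:E); last first.
    by apply: eq_integral => w _; apply/cvg_lim => //; exact: cvg_g.
  apply.
  - by move=> n; exact: mfX.
  - by move=> n w _; rewrite lee_fin.
  - by move=> w _ m n mn; rewrite lee_fin; exact: nd_g.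
apply: cvg_unique lhs _ => //.
rewrite (_ : (fun n => \int[P]_w (W w * g n (X w))%:E) =
  (fun n => c%:E * \int[P]_w (g n (X w))%:E)); last exact/funext.
exact: cvgeZl.
Qed.

Section independent_product.
Context (I : finType) (X : I -> T -> R).
Context (mX : forall i, measurable_fun setT (X i))
  (indep : forall B : I -> set R, (forall i, measurable (B i)) ->
     P (\bigcap_(i in setT) (X i @^-1` B i)) = \prod_i P (X i @^-1` B i)).

Let mpre i B : measurable B -> measurable (X i @^-1` B).
Proof. by move=> mB; rewrite -[X in measurable X]setTI; exact: mX. Qed.

Let int_indic i B : measurable B ->
  \int[P]_w (\1_B (X i w))%:E = P (X i @^-1` B).
Proof.
move=> mB; rewrite -[X in _ = P X]setIT -integral_indic//; exact: mpre.
Qed.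

(* Induction on the number of factors that are not indicators. *)
Let ge0_integral_prod_indep_seq (s : seq I) (f : I -> R -> R) :
  (forall i, measurable_fun setT (f i)) -> (forall i r, 0 <= f i r)%R ->
  (forall i, \int[P]_w (f i (X i w))%:E < +oo) ->
  (forall i, i \notin s -> exists2 B, measurable B & f i = \1_B) ->
  \int[P]_w (\prod_i f i (X i w))%:E =
  (\prod_i fine (\int[P]_w (f i (X i w))%:E))%:E.
Proof.
have Efin (f' : R -> R) i : (forall r, 0 <= f' r)%R ->
    \int[P]_w (f' (X i w))%:E < +oo ->
    (fine (\int[P]_w (f' (X i w))%:E))%:E = \int[P]_w (f' (X i w))%:E.
  move=> f0 ffin; rewrite fineK// ge0_fin_numE//.
  by apply: integral_ge0 => w _; rewrite lee_fin.
elim: s f => [|i s IH] f mf f0 ffin find.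
  have /(_ _)/cid2 B_ i := find i isT.
  pose B i := sval (B_ i).
  have mB i : measurable (B i) by rewrite /B; case: (B_ i).
  have fB i : f i = \1_(B i) by rewrite /B; case: (B_ i).
  under eq_integral do under eq_bigr do rewrite fB.
  rewrite (eq_integral (fun w => (\1_(\bigcap_(i in setT) (X i @^-1` B i)) w)%:E)); last first.
    move=> w _; congr EFin; rewrite indicE.
    have [/set_mem wB|/negP wB] := boolP (w \in _).
      by rewrite big1// => i _; rewrite indicE mem_set//; exact: wB.
    have [i wBi] : exists i, ~ B i (X i w).
      by apply/existsNP => h; apply: wB; apply/mem_set => i _; exact: h.
    by rewrite (bigD1 i)//= indicE memNset// mul0r.
  rewrite integral_indic//; last first.
    by apply: fin_bigcap_measurable => // i _; exact: mpre.
  rewrite setIT; apply: (etrans (indep mB)); rewrite -prodEFin; apply: eq_bigr => i _.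
  rewrite Efin; last exact: ffin.
    by rewrite fB int_indic.
  exact: f0.
pose W w := (\prod_(j | j != i) f j (X j w))%R.
pose c := (\prod_(j | j != i) fine (\int[P]_w (f j (X j w))%:E))%R.
have mW : measurable_fun setT W.
  rewrite /W; under eq_fun do rewrite -big_filter.
  by apply: measurable_prod => j _; exact: measurableT_comp (mf j) (mX j).
have W0 w : (0 <= W w)%R by apply: prodr_ge0 => j _.
have c0 : (0 <= c)%R.
  apply: prodr_ge0 => j _; apply: fine_ge0; apply: integral_ge0 => w _.
  by rewrite lee_fin.
have WB B : measurable B ->
    \int[P]_w (W w * \1_B (X i w))%:E = c%:E * P (X i @^-1` B).
  (* Once factor [i] is an indicator, the list [s] covers all the other kinds of factors, so the
     induction hypothesis applies. *)
  move=> mB; pose f' j : R -> R := if j == i then \1_B else f j.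
  have f'i : f' i = \1_B by rewrite /f' eqxx.
  have f'j j : j != i -> f' j = f j by rewrite /f' => /negbTE ->.
  have := IH f'; rewrite [in RHS](bigD1 i)//= f'i int_indic//.
  rewrite (eq_integral (fun w => (W w * \1_B (X i w))%:E)); last first.
    move=> w _; rewrite (bigD1 i)//= f'i mulrC; congr (_ * _)%:E.
    by apply: eq_bigr => j ji; rewrite f'j.
  move=> ->.
  - rewrite EFinM fineK; last by rewrite fin_num_measure//; exact: mpre.
    rewrite muleC; congr (_%:E * _); apply: eq_bigr => j ji; rewrite f'j//.
  - move=> j; rewrite /f'; case: ifP => _ //; exact: measurable_indic.
  - by move=> j r; rewrite /f'; case: ifP => _ //; rewrite indicE.
  - move=> j; rewrite /f'; case: eqP => [->|_] //.
    by rewrite int_indic// (le_lt_trans (probability_le1 P _)) ?ltry//; exact: mpre.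
  - move=> j js; rewrite /f'; case: eqVneq => [_|ji]; first by exists B.
    by apply: find; rewrite inE negb_or ji.
rewrite (eq_integral (fun w => (W w * f i (X i w))%:E)); last first.
  by move=> w _; rewrite (bigD1 i)//= mulrC.
rewrite (ge0_integral_weighted_indep mW W0 (mX i) c0 WB (mf i) (f0 i)).
by rewrite [in RHS](bigD1 i)//= EFinM Efin// muleC.
Qed.

Lemma ge0_integral_prod_indep (f : I -> R -> R) :
  (forall i, measurable_fun setT (f i)) -> (forall i r, 0 <= f i r)%R ->
  (forall i, \int[P]_w (f i (X i w))%:E < +oo) ->
  \int[P]_w (\prod_i f i (X i w))%:E =
  (\prod_i fine (\int[P]_w (f i (X i w))%:E))%:E.
Proof.
move=> mf f0 ffin; apply: (ge0_integral_prod_indep_seq (s := enum I)) => //.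
by move=> i; rewrite mem_enum.
Qed.

Lemma integrable_prod_indep (f : I -> R -> R) :
  (forall i, measurable_fun setT (f i)) ->
  (forall i, P.-integrable setT (fun w => (f i (X i w))%:E)) ->
  P.-integrable setT (fun w => (\prod_i f i (X i w))%:E).
Proof.
move=> mf fint; apply/integrableP; split.
  apply/measurable_EFinP; apply: measurable_prod => i _.
  exact: measurableT_comp (mf i) (mX i).
under eq_integral do rewrite /= normr_prod.
rewrite (ge0_integral_prod_indep (f := fun i r => `|f i r|%R)) ?ltry//.
  by move=> i; exact: measurableT_comp.
by move=> i; have /integrableP[] := fint i.
Qed.

Lemma Rintegral_sum (K : Type) (s : seq K) (F : K -> T -> R) :
  (forall k, P.-integrable setT (fun w => (F k w)%:E)) ->
  (\int[P]_w \sum_(k <- s) F k w = \sum_(k <- s) \int[P]_w F k w)%R.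
Proof.
move=> Fint; elim: s => [|k s IH].
  rewrite big_nil; under eq_Rintegral do rewrite big_nil.
  by rewrite Rintegral_cst// mul0r.
rewrite big_cons -IH -RintegralD//; [|exact: Fint|].
  by apply: eq_Rintegral => w _; rewrite big_cons.
apply: (eq_integrable _ (fun w => \sum_(k <- s) (F k w)%:E)) => //.
  by move=> w _; rewrite /= sumEFin.
exact: integrable_sum.
Qed.

(* Each factor is a difference of nonnegative functions; expand the product. *)
Lemma Rintegral_prod_indep (f : I -> R -> R) :
  (forall i, measurable_fun setT (f i)) ->
  (forall i, P.-integrable setT (fun w => (f i (X i w))%:E)) ->
  (\int[P]_w \prod_i f i (X i w) = \prod_i \int[P]_w f i (X i w))%R.
Proof.
move=> mf fint.
(* [f i] is the difference of [g i true] and [g i false], two nonnegative integrable functions. *)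
pose g (i : I) (b : bool) r := (`|f i r| + (if b then f i r else 0))%R.
have g0 i b r : (0 <= g i b r)%R.
  rewrite /g; case: b; last by rewrite addr0.
  by have := ler_norm (- f i r)%R; rewrite normrN; lra.
have mg i b : measurable_fun setT (g i b).
  apply: measurable_funD; first exact: measurableT_comp.
  by case: b => //; exact: mf.
have gint i b : P.-integrable setT (fun w => (g i b (X i w))%:E).
  apply: (eq_integrable _ (fun w => `|(f i (X i w))%:E| +
     (if b then f i (X i w) else 0)%:E)) => //.
  apply: integrableD => //; first exact: integrable_abse.
  by case: b => //; exact: integrable0.
have fE i r : f i r = (\sum_(b : bool) (-1) ^+ (~~ b) * g i b r)%R.
  by rewrite big_bool /g/= expr0 expr1; ring.
pose sg (b : {ffun I -> bool}) : R := (\prod_i (-1) ^+ (~~ b i))%R.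
have gprod (b : {ffun I -> bool}) :
    (\int[P]_w \prod_i g i (b i) (X i w) = \prod_i \int[P]_w g i (b i) (X i w))%R.
  rewrite /Rintegral (ge0_integral_prod_indep (f := fun i => g i (b i)))//.
  move=> i; have /integrableP[_] := gint i (b i).
  by under eq_integral do rewrite /= ger0_norm//.
have gprodint (b : {ffun I -> bool}) :
    P.-integrable setT (fun w => (\prod_i g i (b i) (X i w))%:E).
  by apply: (integrable_prod_indep (f := fun i => g i (b i))).
have -> : (\int[P]_w \prod_i f i (X i w) =
    \int[P]_w \sum_(b : {ffun I -> bool}) sg b * \prod_i g i (b i) (X i w))%R.
  apply: eq_Rintegral => w _; under eq_bigr do rewrite fE.
  rewrite bigA_distr_bigA; apply: eq_bigr => b _.
  by rewrite big_split.
rewrite Rintegral_sum; last first.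
  by move=> b; under eq_fun do rewrite EFinM; exact: integrableZl.
have -> : (\prod_i \int[P]_w f i (X i w) =
    \prod_i \sum_(b : bool) (-1) ^+ (~~ b) * \int[P]_w g i b (X i w))%R.
  apply: eq_bigr => i _; rewrite big_bool/= expr0 expr1 mul1r mulN1r -RintegralB//; [|exact: gint..].
  by apply: eq_Rintegral => w _; rewrite /g; ring.
rewrite bigA_distr_bigA; apply: eq_bigr => b _.
by rewrite RintegralZl//; [rewrite gprod big_split|exact: gprodint].
Qed.

End independent_product.
End independence.

(** * The integral as an expectation functional on polynomials *)

Section monomials.
Context {R : realType} {T : Type} {I : finType} (x : I -> T -> R).

(** Independence gives a product formula for monomials, so polynomial functions are first expanded
    into them; the zero exponents off [J] retain which variables occur. *)
Lemma polyfun_monomials (J : set I) f : polyfun x J f ->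
  exists2 s : seq (R * {ffun I -> nat}),
    (forall c, c \in s -> forall i, ~ J i -> c.2 i = 0%N) &
    f = (fun w => \sum_(c <- s) c.1 * \prod_i x i w ^+ c.2 i).
Proof.
pose mulm (c e : R * {ffun I -> nat}) : R * {ffun I -> nat} :=
  (c.1 * e.1, [ffun i => (c.2 i + e.2 i)%N]).
elim=> [c|i Ji|g h _ [s sJ gE] _ [t tJ hE]|g h _ [s sJ gE] _ [t tJ hE]].
- exists [:: (c, [ffun=> 0%N])].
    by move=> c'; rewrite inE => /eqP -> i _; rewrite ffunE.
  apply/funext => w; rewrite big_seq1 big1 ?mulr1// => i _.
  by rewrite ffunE expr0.
- exists [:: (1, [ffun j => (j == i) : nat])].
    move=> c'; rewrite inE => /eqP -> j Jj; rewrite ffunE.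
    by case: eqP => // ji; rewrite ji in Jj.
  apply/funext => w; rewrite big_seq1 mul1r (bigD1 i)//= ffunE eqxx expr1.
  by rewrite big1 ?mulr1// => j ji; rewrite ffunE (negbTE ji) expr0.
- exists (s ++ t); last by apply/funext => w; rewrite big_cat gE hE.
  by move=> c; rewrite mem_cat => /orP[/sJ|/tJ].
- exists [seq mulm c e | c <- s, e <- t].
    move=> _ /allpairsP[[c e]/= [cs et ->]] i Ji.
    by rewrite ffunE (sJ _ cs)// (tJ _ et).
  apply/funext => w; rewrite gE hE big_allpairs_dep mulr_suml.
  apply: eq_bigr => c _; rewrite mulr_sumr; apply: eq_bigr => e _.
  have -> : \prod_i x i w ^+ (mulm c e).2 i =
      (\prod_i x i w ^+ c.2 i) * \prod_i x i w ^+ e.2 i.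
    by rewrite -big_split/=; apply: eq_bigr => i _; rewrite ffunE exprD.
  by rewrite /mulm/=; ring.
Qed.

End monomials.

Section expectation_of_polynomials.
Context d {T : measurableType d} {R : realType} (P : probability T R).
Context {I : finType} (x : I -> T -> R).
Context (xint : forall k : I -> nat,
    P.-integrable setT (fun w => (\prod_i x i w ^+ k i)%:E))
  (xprod : forall k : I -> nat,
    \int[P]_w \prod_i x i w ^+ k i = \prod_i \int[P]_w (x i w ^+ k i)).

Lemma polyfun_integrable (J : set I) f : polyfun x J f ->
  P.-integrable setT (EFin \o f).
Proof.
move=> /polyfun_monomials[s _ ->].
apply: (eq_integrable _ (fun w =>
   (\sum_(c <- s) c.1%:E * (\prod_i x i w ^+ c.2 i)%:E)%E)) => //.
  by move=> w _; rewrite /= -sumEFin; apply: eq_bigr => c _; rewrite EFinM.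
by apply: integrable_sum => // c _; exact: integrableZl.
Qed.

Lemma Rintegral_expectation_functional :
  expectation_functional x (fun f => \int[P]_w f w).
Proof.
have P1 : fine (P setT) = 1 by rewrite probability_setT.
split.
- move=> a f g pf pg.
  rewrite RintegralD//; [|exact: polyfun_integrable (polyfunZ a pf)
                         |exact: polyfun_integrable pg].
  by rewrite RintegralZl//; exact: polyfun_integrable pf.
- move=> f g pf pg fg; apply: le_Rintegral => //.
  + exact: polyfun_integrable pf.
  + exact: polyfun_integrable pg.
- by rewrite Rintegral_cst// P1 mulr1.
move=> i r f /polyfun_monomials[s sJ ->].
pose m (k : I -> nat) w := \prod_j x j w ^+ k j.
(* The exponent at [i] is zero in every monomial of [f], so multiplying by [x i w ^+ r] overwrites
   it. *)
pose up (c : {ffun I -> nat}) j := if j == i then r else c j.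
have -> : (fun w => x i w ^+ r * (\sum_(c <- s) c.1 * \prod_j x j w ^+ c.2 j)) =
    (fun w => \sum_(c <- s) c.1 * m (up c.2) w).
  apply/funext => w; rewrite mulr_sumr big_seq [RHS]big_seq.
  apply: eq_bigr => c cs; rewrite mulrCA; congr (_ * _).
  rewrite /m (bigD1 i)//= [RHS](bigD1 i)//= /up eqxx.
  rewrite (sJ _ cs)//=.
  rewrite expr0 mul1r; congr (_ * _); apply: eq_bigr => j /negbTE ji.
  by rewrite ji.
have mint k c : P.-integrable setT (fun w => (c * m k w)%:E).
  by under eq_fun do rewrite EFinM; apply: integrableZl => //; exact: xint.
rewrite Rintegral_sum; last by move=> c; exact: mint.
rewrite [in RHS]Rintegral_sum; last by move=> c; exact: mint.
rewrite mulr_sumr big_seq [RHS]big_seq; apply: eq_bigr => c cs.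
rewrite RintegralZl//; last exact: xint.
rewrite RintegralZl//; last exact: xint.
rewrite mulrCA; congr (_ * _); rewrite /m !xprod.
rewrite (bigD1 i)//= [in RHS](bigD1 i)//= /up eqxx.
congr (_ * _); rewrite (sJ _ cs)//=.
under [in RHS]eq_Rintegral do rewrite expr0.
rewrite Rintegral_cst// P1 mulr1 mul1r; apply: eq_bigr => j /negbTE ji.
by rewrite ji.
Qed.

End expectation_of_polynomials.

(** * Moments of variables with bounded psi-norm and of Bernoulli variables *)

Section psi_moments.
Context d {T : measurableType d} {R : realType} (P : probability T R).

(** This is [y / s <= exp (y / s)] raised to the power [s], for [s = r / alpha] and [y] the argument
    of the exponential. *)
Lemma exprn_le_psi (alpha t z : R) (r : nat) : 0 < alpha -> 0 < t -> (0 < r)%N ->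
  `|z| ^+ r <= t ^+ r * (r%:R / alpha) `^ (r%:R / alpha) *
    expR (`|z| `^ alpha / t `^ alpha).
Proof.
move=> a0 t0 r0; set s := r%:R / alpha; set y := _ / _.
have s0 : 0 < s by rewrite divr_gt0// ltr0n.
have y0 : 0 <= y by rewrite divr_ge0// powR_ge0.
have h : (y / s) `^ s <= expR y.
  have -> : expR y = expR (y / s) `^ s by rewrite -expRM mulfVK// gt_eqF.
  have ys0 : 0 <= y / s by apply: divr_ge0 => //; exact: ltW.
  apply: ge0_ler_powR; rewrite ?nnegrE ?expR_ge0 ?(ltW s0)//.
  by apply: (le_trans _ (expR_ge1Dx _)); rewrite lerDr.
have as_ : alpha * s = r%:R by rewrite mulrC divfK// gt_eqF.
have powr_s u : 0 <= u -> u ^+ r = (u `^ alpha) `^ s.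
  by move=> u0; rewrite -powRrM as_ powR_mulrn.
suff -> : `|z| ^+ r = t ^+ r * s `^ s * (y / s) `^ s.
  by apply: ler_wpM2l => //; rewrite mulr_ge0 ?powR_ge0// exprn_ge0// ltW.
have ys0 : 0 <= y / s by apply: divr_ge0 => //; exact: ltW.
rewrite -mulrA -powRM ?(ltW s0)// [s * _]mulrC divfK ?gt_eqF//.
rewrite !powr_s ?(ltW t0)// -powRM ?powR_ge0//.
by rewrite mulrC divfK// gt_eqF// powR_gt0.
Qed.

(** The strict hypothesis yields an admissible [u < t], so the infimum need not be attained; the
    factor 2 is the bound on the exponential moment. *)
Lemma psi_norm_moment (alpha t : R) (Z : {RV P >-> R}) (r : nat) : 0 < alpha ->
  (psi_norm alpha Z < t%:E)%E -> (0 < r)%N ->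
  (\int[P]_w (`|Z w| ^+ r)%:E <=
   (2 * t ^+ r * (r%:R / alpha) `^ (r%:R / alpha))%:E)%E.
Proof.
move=> a0 /ereal_inf_lt[_ [u [u0 Eu] <-]]; rewrite lte_fin => ut r0.
set C := (_ / _) `^ _; have C0 : 0 <= C by exact: powR_ge0.
have mexp : measurable_fun setT (fun w => expR (`|Z w| `^ alpha / u `^ alpha)).
  apply: measurableT_comp => //; apply: measurable_funM => //.
  apply: (measurableT_comp (f := @powR R ^~ alpha)); last exact: measurableT_comp.
  exact: measurable_powR.
apply: (@le_trans _ _
  (\int[P]_w ((u ^+ r * C)%:E * (expR (`|Z w| `^ alpha / u `^ alpha))%:E))%E).
  apply: ge0_le_integral => //.
  - apply/measurable_EFinP; apply: measurable_funX; exact: measurableT_comp.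
  - apply/measurable_EFinP; apply: measurable_funM => //.
  - by move=> w _; rewrite lee_fin; exact: exprn_le_psi.
rewrite ge0_integralZl//; last 2 first.
- exact/measurable_EFinP.
- by rewrite lee_fin mulr_ge0// exprn_ge0// ltW.
move: Eu; rewrite unlock => Eu.
apply: (@le_trans _ _ ((u ^+ r * C)%:E * 2%:E)%E).
  by rewrite lee_wpmul2l// lee_fin mulr_ge0// exprn_ge0// ltW.
rewrite -EFinM lee_fin mulrC mulrA; apply: ler_wpM2r => //.
by apply: ler_wpM2l => //; apply: lerXn2r; rewrite ?nnegrE ltW// (lt_trans u0).
Qed.

Lemma psi_norm_integrable (alpha t : R) (Z : {RV P >-> R}) (r : nat) : 0 < alpha ->
  (psi_norm alpha Z < t%:E)%E -> P.-integrable setT (fun w => (Z w ^+ r)%:E).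
Proof.
move=> a0 Zt; apply/integrableP; split.
  by apply/measurable_EFinP; exact: measurable_funX.
case: r => [|r].
  under eq_integral do rewrite expr0 /= normr1.
  by rewrite integral_cst// mul1e (le_lt_trans (probability_le1 P _)) ?ltry.
under eq_integral do rewrite /= normrX.
by apply: le_lt_trans (psi_norm_moment a0 Zt _) _ => //; rewrite ltry.
Qed.

End psi_moments.

Section bernoulli_moments.
Context d {T : measurableType d} {R : realType} (P : probability T R).
Context (p : R) (X : {RV P >-> R}) (Xp : is_bernoulli p X).

Let X1 : measurable (X @^-1` [set 1 : R]).
Proof. by rewrite -[X in measurable X]setTI; exact: measurable_funP. Qed.

(** The values 0 and 1 are taken only almost surely, so moments are computed through an indicator
    that is equal almost everywhere. *)
Lemma bernoulli_ae (r : nat) : (0 < r)%N ->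
  {ae P, forall w, (X w ^+ r)%:E = (\1_(X @^-1` [set 1 : R]) w)%:E}.
Proof.
move=> r0; case: Xp => + _; apply: filterS => w [Xw|Xw]; congr EFin.
  rewrite Xw expr0n (gtn_eqF r0) indicE memNset//= Xw => /esym/eqP.
  by rewrite oner_eq0.
by rewrite Xw expr1n indicE mem_set.
Qed.

Lemma bernoulli_integral (r : nat) : (0 < r)%N ->
  (\int[P]_w (X w ^+ r)%:E = p%:E)%E.
Proof.
move=> r0; rewrite (ae_eq_integral (fun w => (\1_(X @^-1` [set 1 : R]) w)%:E))//.
- by rewrite integral_indic// setIT; case: Xp.
- by apply/measurable_EFinP; exact: measurable_funX.
- by apply/measurable_EFinP; exact: measurable_indic.
- by apply: filterS (bernoulli_ae r0) => w + _.
Qed.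

Lemma bernoulli_integrable (r : nat) : P.-integrable setT (fun w => (X w ^+ r)%:E).
Proof.
case: r => [|r].
  by under eq_fun do rewrite expr0; exact: finite_measure_integrable_cst.
apply/integrableP; split; first by apply/measurable_EFinP; exact: measurable_funX.
rewrite (ae_eq_integral (fun w => (\1_(X @^-1` [set 1 : R]) w)%:E))//.
- by rewrite integral_indic// (le_lt_trans (probability_le1 P _)) ?ltry// setIT.
- by apply/measurable_EFinP; apply: measurableT_comp => //; exact: measurable_funX.
- by apply/measurable_EFinP; exact: measurable_indic.
- by apply: filterS (bernoulli_ae (ltn0Sn r)) => w /= [->] _; rewrite ger0_norm.
Qed.

End bernoulli_moments.

(** * Sparse alpha-sub-exponential vectors *)

Section sparse_variables.
Context d {T : measurableType d} {R : realType} (P : probability T R).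
Context (n : nat) (delta zeta : 'I_n -> {RV P >-> R}).
Context (ind : independent_families delta zeta)
  (ind_delta : mutually_independent delta) (ind_zeta : mutually_independent zeta).

Definition joint_family (s : 'I_n + 'I_n) : T -> R :=
  match s with inl i => delta i | inr i => zeta i end.

Lemma bigcap_g_sigma_preimage (X : 'I_n -> {RV P >-> R}) (B : 'I_n -> set R) :
  (forall i, measurable (B i)) ->
  g_sigma_preimage (fun i => X i : T -> R)
    (\bigcap_(i in [set` [set: 'I_n]%SET]) (X i @^-1` B i)).
Proof.
move=> mB; set G := \big[setU/set0]_(i < n) preimage_set_system setT (X i) measurable.
have GX i : <<s G >> (X i @^-1` B i).
  apply: sub_sigma_algebra; rewrite /G -bigcup_seq; exists i => /=.
    by rewrite mem_index_enum.
  by exists (B i) => //; rewrite setTI.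
(* A sigma-algebra is closed under complements and countable unions, so the finite intersection is
   rewritten with these; natural numbers from [n] on contribute the empty set. *)
have -> : \bigcap_(i in [set` [set: 'I_n]%SET]) (X i @^-1` B i) =
    ~` (\bigcup_k (if insub k is Some i then ~` (X i @^-1` B i) else set0)).
  rewrite setC_bigcup; apply/seteqP; split => w /= h.
    move=> k _; case: insubP => [i _ _|_]; last by rewrite setC0.
    by rewrite setCK; apply: h => /=; rewrite finset.in_setT.
  move=> i _; have := h (val i) I; rewrite valK setCK.
  exact.
have [G0 GC GU] := smallest_sigma_algebra setT G.
rewrite -setTD; apply: (GC); apply: GU => k; case: insub => [i|] //.
by rewrite -setTD; apply: GC; exact: GX.
Qed.

(** A rectangle of the joint family is the intersection of one event from each generated
    sigma-algebra. Independence of the two families separates these events, and mutual independence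
    factors each of them. *)
Lemma joint_family_independent (B : 'I_n + 'I_n -> set R) :
  (forall s, measurable (B s)) ->
  P (\bigcap_(s in setT) (joint_family s @^-1` B s)) =
  (\prod_s P (joint_family s @^-1` B s))%E.
Proof.
move=> mB; rewrite big_sumType/=.
have indX (X : 'I_n -> {RV P >-> R}) (C : 'I_n -> set R) : mutually_independent X ->
    (forall i, measurable (C i)) ->
    P (\bigcap_(i in [set` [set: 'I_n]%SET]) (X i @^-1` C i)) =
    (\prod_i P (X i @^-1` C i))%E.
  by move=> iX mC; rewrite iX//; apply: eq_bigl => i; rewrite finset.in_setT.
rewrite -(indX delta (fun i => B (inl i)))// -(indX zeta (fun i => B (inr i)))//.
rewrite -ind; [|exact: bigcap_g_sigma_preimage..].
congr (P _); apply/seteqP; split => w /=.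
  by move=> h; split=> i _; [exact: (h (inl i))|exact: (h (inr i))].
by case=> h1 h2 [i|i] _; [apply: h1|apply: h2] => /=; rewrite finset.in_setT.
Qed.

Context (deltaint : forall i r, P.-integrable setT (fun w => (delta i w ^+ r)%:E))
  (zetaint : forall i r, P.-integrable setT (fun w => (zeta i w ^+ r)%:E)).

Definition sparse_family (i : 'I_n) (w : T) : R := delta i w * zeta i w.

Let exponents (k : 'I_n -> nat) (s : 'I_n + 'I_n) :=
  match s with inl i => k i | inr i => k i end.

Let jointint (k : 'I_n -> nat) s :
  P.-integrable setT (fun w => (joint_family s w ^+ exponents k s)%:E).
Proof. by case: s => i; [exact: deltaint|exact: zetaint]. Qed.

Let mjoint s : measurable_fun setT (joint_family s).
Proof. by case: s => i; exact: measurable_funP. Qed.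

Let monomialE (k : 'I_n -> nat) w : \prod_i sparse_family i w ^+ k i =
  \prod_s joint_family s w ^+ exponents k s.
Proof.
by rewrite big_sumType/= -big_split/=; apply: eq_bigr => i _; rewrite exprMn.
Qed.

Let mexp (k : 'I_n -> nat) s :
  measurable_fun setT (fun r : R => r ^+ exponents k s).
Proof. exact: exprn_measurable. Qed.

Lemma sparse_monomial_integrable (k : 'I_n -> nat) :
  P.-integrable setT (fun w => (\prod_i sparse_family i w ^+ k i)%:E).
Proof.
under eq_fun do rewrite monomialE.
exact: (integrable_prod_indep mjoint joint_family_independent
  (f := fun s r => r ^+ exponents k s)).
Qed.

Let sparse_monomial_integral (k : 'I_n -> nat) :
  \int[P]_w (\prod_i sparse_family i w ^+ k i) =
  \prod_i (\int[P]_w (delta i w ^+ k i) * \int[P]_w (zeta i w ^+ k i)).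
Proof.
under eq_Rintegral do rewrite monomialE.
rewrite (Rintegral_prod_indep mjoint joint_family_independent
  (f := fun s r => r ^+ exponents k s))//.
by rewrite big_sumType/= big_split.
Qed.

Lemma sparse_moment i r : \int[P]_w (sparse_family i w ^+ r) =
  \int[P]_w (delta i w ^+ r) * \int[P]_w (zeta i w ^+ r).
Proof.
have P1 : fine (P setT) = 1 by rewrite probability_setT.
have := sparse_monomial_integral (fun j => if j == i then r else 0%N).
have E0 (f : T -> R) : \int[P]_w (f w ^+ 0) = 1.
  by under eq_Rintegral do rewrite expr0; rewrite Rintegral_cst// P1 mulr1.
rewrite [RHS](bigD1 i)//= eqxx big1 ?mulr1 => [<-|j /negbTE ->]; last first.
  by rewrite !E0 mulr1.
apply: eq_Rintegral => w _; rewrite (bigD1 i)//= eqxx big1 ?mulr1// => j.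
by move=> /negbTE ->; rewrite expr0.
Qed.

Lemma sparse_expectation_functional :
  expectation_functional sparse_family (fun f => \int[P]_w f w).
Proof.
apply: Rintegral_expectation_functional; first exact: sparse_monomial_integrable.
move=> k; rewrite sparse_monomial_integral.
by apply: eq_bigr => i _; rewrite sparse_moment.
Qed.

End sparse_variables.

Section psi_constants.
Context {R : realType} (alpha : R) (alpha0 : 0 < alpha) (alpha2 : alpha <= 2).

Let gam : R := 2 / alpha - 1.
Let a : R := (2 / alpha) `^ (2 / alpha).
Let a2 : R := (4 / alpha) `^ (2 / alpha).
Let b : R := (2 `^ gam) ^+ 2.

(** A sum that dominates each requirement separately: being at least 1, the moments of [zeta] in
    [psi_even_moment_le], and those of its square in [psi_fourth_moment_le]. *)
Definition psi_const : R := 1 + 2 * a + 8 * a2 ^+ 2 * b.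
Definition psi_scale (k : nat) : R := k%:R `^ (2 / alpha - 1).

Let gam0 : 0 <= gam.
Proof. by rewrite subr_ge0 ler_pdivlMr// mul1r. Qed.
Let a0 : 0 <= a. Proof. exact: powR_ge0. Qed.
Let a20 : 0 <= a2. Proof. exact: powR_ge0. Qed.
Let b0 : 0 <= b. Proof. exact/exprn_ge0/powR_ge0. Qed.

Lemma psi_const_ge1 : 1 <= psi_const.
Proof. by rewrite /psi_const -addrA lerDl; nonneg. Qed.

Lemma psi_scale_ge1 k : (0 < k)%N -> 1 <= psi_scale k.
Proof.
move=> k0; have {1}-> : 1 = 1 `^ gam :> R by rewrite powR1.
by apply: ge0_ler_powR => //; rewrite ?nnegrE// ler1n.
Qed.

Let psi_scale_le j k : (j <= k)%N -> psi_scale j <= psi_scale k.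
Proof. by move=> jk; apply: ge0_ler_powR; rewrite ?nnegrE// ler_nat. Qed.

Lemma mul_psi_scale k : (0 < k)%N -> k%:R * psi_scale k = k%:R `^ (2 / alpha).
Proof.
move=> k0; rewrite -[X in X * _]powRr1// -powRD; first by rewrite addrC subrK.
by apply/implyP => _; rewrite pnatr_eq0 -lt0n.
Qed.

Let powR_nat_split (c : R) (j r : nat) : 0 < c -> (0 < j)%N ->
  (c * j%:R) `^ (r%:R * (2 / alpha)) =
  ((c `^ (2 / alpha)) * (j%:R * psi_scale j)) ^+ r.
Proof.
move=> c0 j0; rewrite mulrC [X in _ `^ X]mulrC mulrC powRrM powR_mulrn ?powR_ge0//.
by rewrite powRM ?(ltW c0)// mul_psi_scale.
Qed.

Let expn_le_gauss_weight (j : nat) : j%:R ^+ j <= gauss_weight j :> R.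
Proof.
rewrite /gauss_weight ler_pdivlMr ?ltr0n ?fact_gt0// -natrX -natrM ler_nat.
have h i : (j ^ i * j`! <= (j + i)`!)%N.
  elim: i => [|i IH]; first by rewrite addn0 expn0 mul1n.
  have -> : ((j + i.+1)`! = (j + i).+1 * (j + i)`!)%N by rewrite addnS factS.
  have -> : (j ^ i.+1 * j`! = j * (j ^ i * j`!))%N by rewrite expnS mulnA.
  by apply: leq_mul IH; rewrite -addnS leq_addr.
by rewrite -addnn; exact: h.
Qed.

(** The left side is the bound of [psi_norm_moment] at order [2j]. It grows like the [j]-th power of
    [j * psi_scale j]; the scale is monotone because [alpha <= 2], and [j ^ j] is at most the
    Gaussian weight. *)
Lemma psi_even_moment_le (l : R) (k j : nat) : 0 <= l -> (0 < j <= k)%N ->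
  2 * l ^+ j.*2 * ((j.*2)%:R / alpha) `^ ((j.*2)%:R / alpha) <=
  (psi_const * l ^+ 2 * psi_scale k) ^+ j * gauss_weight j.
Proof.
move=> l0 /andP[j0 jk].
have -> : (j.*2)%:R / alpha = 2 / alpha * j%:R :> R by rewrite -mul2n natrM; ring.
rewrite [X in _ `^ X]mulrC powR_nat_split ?divr_gt0// -/a.
have sk0 : 0 <= psi_scale k by exact: powR_ge0.
have sj0 : 0 <= psi_scale j by exact: powR_ge0.
apply: (@le_trans _ _ ((2 * a * l ^+ 2 * psi_scale k) ^+ j * j%:R ^+ j)).
  apply: (@le_trans _ _ (2 ^+ j * l ^+ j.*2 * (a * (j%:R * psi_scale k)) ^+ j)).
    apply: ler_pM; [by nonneg|by nonneg| |].
      apply: ler_wpM2r; first by nonneg.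
      by rewrite -[leLHS]expr1 ler_weXn2l// ler1n.
    apply: lerXn2r; [by nonneg|by nonneg|].
    apply: ler_wpM2l => //; apply: ler_wpM2l => //; exact: psi_scale_le.
  rewrite -mul2n (exprM l) -!exprMn le_eqVlt; apply/orP; left; apply/eqP.
  by congr (_ ^+ _); ring.
apply: ler_pM; [by nonneg|by nonneg| |exact: expn_le_gauss_weight].
have C0 : 0 <= psi_const by apply: le_trans psi_const_ge1.
apply: lerXn2r; [by nonneg|by nonneg|].
apply: ler_wpM2r => //; apply: ler_wpM2r; first by nonneg.
by rewrite /psi_const addrAC lerDr; nonneg.
Qed.

(** The left side produces [j.+1] squares of the scale and the right side offers only [j]. The
    remaining [psi_scale j.+1 ^+ 2] is at most [b ^+ j.+1] because [j.+1 <= 2 ^ j.+1], so the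
    leading constant does not depend on [k]. *)
Lemma psi_fourth_moment_le (l : R) (k j : nat) : 0 <= l -> (j < k)%N ->
  2 * l ^+ (j.+1.*2).*2 *
    (((j.+1.*2).*2)%:R / alpha) `^ (((j.+1.*2).*2)%:R / alpha) <=
  (psi_const * l ^+ 4) * ((psi_const * l ^+ 2 * psi_scale k) ^+ 2) ^+ j *
    (j.+1.*2)`!%:R.
Proof.
move=> l0 jk; set J := j.+1.
have J0 : (0 < J)%N by [].
have e1 : ((J.*2).*2)%:R / alpha = 4 / alpha * J%:R :> R.
  by rewrite -!mul2n !natrM; ring.
have e2 : ((J.*2).*2)%:R / alpha = (J.*2)%:R * (2 / alpha) :> R.
  by rewrite -[(J.*2).*2]mul2n natrM; ring.
rewrite {1}e1 e2 powR_nat_split ?divr_gt0// -/a2.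
have sk0 : 0 <= psi_scale k by exact: powR_ge0.
have sj0 : 0 <= psi_scale J by exact: powR_ge0.
have C1 := psi_const_ge1; have C0 : 0 <= psi_const by apply: le_trans C1.
have sJk : psi_scale J <= psi_scale k by exact: psi_scale_le.
have sJ2 : psi_scale J ^+ 2 <= b ^+ J.
  rewrite /b -exprM mulnC exprM; apply: lerXn2r; rewrite ?nnegrE ?exprn_ge0 ?powR_ge0//.
  rewrite -powR_mulrn ?powR_ge0// -powRrM mulrC powRrM /psi_scale.
  apply: ge0_ler_powR; rewrite ?nnegrE ?powR_ge0//.
  by rewrite powR_mulrn// -natrX ler_nat; apply/ltnW/ltn_expl.
(* The square of [J ^ J <= gauss_weight J], where the squared weight is a central binomial
   coefficient times [(2J)!]. *)
have J2 : (J%:R ^+ J.*2 : R) <= 4 ^+ J * (J.*2)`!%:R.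
  have h := expn_le_gauss_weight J.
  apply: (@le_trans _ _ (gauss_weight J ^+ 2)).
    by rewrite -mul2n mulnC exprM; apply: lerXn2r; rewrite ?nnegrE ?exprn_ge0 ?gauss_weight_ge0.
  have bin4 : ('C(J.*2, J)%:R : R) <= 4 ^+ J.
    have -> : 4 ^+ J = (2 ^ J.*2)%:R :> R.
      by rewrite natrX -mul2n exprM; congr (_ ^+ _); ring.
    rewrite ler_nat -[X in (_ <= X ^ _)%N]/(1 + 1)%N expnDn.
    have JJ : (J < J.*2.+1)%N by rewrite ltnS -addnn leq_addr.
    by rewrite (bigD1 (Ordinal JJ))//= !exp1n !muln1 leq_addr.
  have -> : gauss_weight J ^+ 2 = 'C(J.*2, J)%:R * (J.*2)`!%:R :> R.
    have fne m : m`!%:R != 0 :> R by rewrite pnatr_eq0 -lt0n fact_gt0.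
    have e : 'C(J.*2, J)%:R * (J`!%:R * J`!%:R) = (J.*2)`!%:R :> R.
      by have := @bin_fact (J.*2) J; rewrite -addnn addnK leq_addr => /(_ isT) <-; rewrite !natrM.
    by rewrite /gauss_weight -e; field; exact: fne.
  exact: ler_wpM2r.
apply: (@le_trans _ _ ((8 * a2 ^+ 2 * b) ^+ J * l ^+ J.*2.*2 * psi_scale k ^+ j.*2 * (J.*2)`!%:R)).
  have -> : (a2 * (J%:R * psi_scale J)) ^+ J.*2 =
     a2 ^+ J.*2 * (J%:R ^+ J.*2 * (psi_scale J ^+ j.*2 * psi_scale J ^+ 2)).
    by rewrite -exprD addn2 -doubleS !exprMn.
  apply: (@le_trans _ _ (2 ^+ J * l ^+ J.*2.*2 * (a2 ^+ J.*2 *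
     ((4 ^+ J * (J.*2)`!%:R) * (psi_scale k ^+ j.*2 * b ^+ J))))).
    apply: ler_pM; [by nonneg|by nonneg| |].
      apply: ler_wpM2r; first by nonneg.
      by rewrite -[leLHS]expr1 ler_weXn2l// ler1n.
    apply: ler_wpM2l; first by nonneg.
    apply: ler_pM; [by nonneg|by nonneg|by []|].
    apply: ler_pM; [by nonneg|by nonneg| |by []].
    by apply: lerXn2r; rewrite ?nnegrE.
  have -> : (8 * a2 ^+ 2 * b) ^+ J = 2 ^+ J * 4 ^+ J * a2 ^+ J.*2 * b ^+ J.
    rewrite (exprMn J (8 * a2 ^+ 2)) (exprMn J 8) -exprM mul2n.
    by rewrite (_ : 8 = 2 * 4 :> R); [rewrite (exprMn J 2)|ring].
  by rewrite le_eqVlt; apply/orP; left; apply/eqP; ring.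
apply: ler_wpM2r => //.
have -> : psi_const * l ^+ 4 * ((psi_const * l ^+ 2 * psi_scale k) ^+ 2) ^+ j =
  psi_const ^+ j.*2.+1 * l ^+ J.*2.*2 * psi_scale k ^+ j.*2.
  have -> : (J.*2.*2 = 4 + 2 * j.*2)%N by rewrite /J !doubleS mul2n.
  rewrite -exprM mul2n (exprMn j.*2 (psi_const * l ^+ 2)) (exprMn j.*2 psi_const).
  by rewrite -(exprM l) (exprD l 4) (exprS psi_const); ring.
apply: ler_wpM2r; first by nonneg.
apply: ler_wpM2r; first by nonneg.
apply: (@le_trans _ _ (psi_const ^+ J)).
  apply: lerXn2r; [by nonneg|by nonneg|].
  by rewrite /psi_const lerDr; nonneg.
by apply: ler_weXn2l => //; rewrite /J ltnS -addnn leq_addr.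
Qed.

End psi_constants.

(** * Tail bounds *)

Section norms.
Context {R : realType}.

Lemma cauchy_schwarz_sum (K : finType) (a b : K -> R) :
  (\sum_i a i * b i) ^+ 2 <= (\sum_i a i ^+ 2) * (\sum_i b i ^+ 2).
Proof.
set S := \sum_i a i ^+ 2; set B := \sum_i b i ^+ 2; set D := \sum_i a i * b i.
have S0 : 0 <= S by apply: sumr_ge0 => i _; exact: sqr_ge0.
have [S00|Sn0] := eqVneq S 0.
  have a0 i : a i = 0.
    apply/eqP; rewrite -sqrf_eq0; move/eqP: S00.
    by rewrite psumr_eq0 => [/allP/(_ i (mem_index_enum i))|j _]; last exact: sqr_ge0.
  by rewrite S00 mul0r /D big1 ?expr0n// => i _; rewrite a0 mul0r.
have Sp : 0 < S by rewrite lt_neqAle eq_sym Sn0.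
have : 0 <= \sum_i (S * b i - D * a i) ^+ 2.
  by apply: sumr_ge0 => i _; exact: sqr_ge0.
have -> : \sum_i (S * b i - D * a i) ^+ 2 = S * (S * B - D ^+ 2).
  transitivity (\sum_i (S ^+ 2 * b i ^+ 2 + (- 2 * S * D) * (a i * b i) + D ^+ 2 * a i ^+ 2)).
    by apply: eq_bigr => i _; ring.
  by rewrite !big_split/= -!mulr_sumr -/S -/B -/D; ring.
by rewrite pmulr_rge0// subr_ge0.
Qed.

Lemma l2norm_ge0 n (x : 'cV[R]_n) : 0 <= l2norm x.
Proof. exact: sqrtr_ge0. Qed.

Lemma sqr_l2norm n (x : 'cV[R]_n) : l2norm x ^+ 2 = \sum_i x i 0 ^+ 2.
Proof. by rewrite sqr_sqrtr// sumr_ge0// => i _; exact: sqr_ge0. Qed.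

Lemma l2normZ n (c : R) (x : 'cV[R]_n) : 0 <= c -> l2norm (c *: x) = c * l2norm x.
Proof.
move=> c0; rewrite /l2norm; under eq_bigr do rewrite mxE exprMn.
by rewrite -mulr_sumr sqrtrM ?sqr_ge0// sqrtr_sqr ger0_norm.
Qed.

Lemma frobenius_normZ m n (c : R) (A : 'M[R]_(m, n)) : 0 <= c ->
  frobenius_norm (c *: A) = c * frobenius_norm A.
Proof.
move=> c0; rewrite /frobenius_norm.
under eq_bigr do under eq_bigr do rewrite mxE exprMn.
under eq_bigr do rewrite -mulr_sumr.
by rewrite -mulr_sumr sqrtrM ?sqr_ge0// sqrtr_sqr ger0_norm.
Qed.

Lemma l2norm_mulmx_frobenius m n (A : 'M[R]_(m, n)) (x : 'cV[R]_n) :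
  l2norm (A *m x) <= frobenius_norm A * l2norm x.
Proof.
rewrite -(@ler_pXn2r _ 2)// ?nnegrE ?mulr_ge0 ?sqrtr_ge0//.
rewrite exprMn !sqr_l2norm /frobenius_norm sqr_sqrtr; last first.
  by apply: sumr_ge0 => i _; apply: sumr_ge0 => j _; exact: sqr_ge0.
rewrite mulr_suml; apply: ler_sum => i _; rewrite mxE.
exact: cauchy_schwarz_sum.
Qed.

Lemma l2norm_mulmx_le m n (A : 'M[R]_(m, n)) (x : 'cV[R]_n) :
  l2norm (A *m x) <= spectral_norm A * l2norm x.
Proof.
(* A real [sup] is an upper bound only for a nonempty bounded set; the Frobenius norm supplies the
   bound. *)
have hs : has_sup [set l2norm (A *m y) | y in [set y : 'cV[R]_n | l2norm y <= 1]].
  split.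
    exists (l2norm (A *m 0)), 0 => //=.
    by rewrite /l2norm big1 ?sqrtr0// => i _; rewrite mxE expr0n.
  exists (frobenius_norm A) => _ [y /= y1 <-].
  apply: (le_trans (l2norm_mulmx_frobenius A y)).
  by rewrite ler_piMr// sqrtr_ge0.
have [x0|xn0] := eqVneq (l2norm x) 0.
  by have := l2norm_mulmx_frobenius A x; rewrite x0 !mulr0.
have xp : 0 < l2norm x by rewrite lt_neqAle eq_sym xn0 l2norm_ge0.
have xi0 : 0 <= (l2norm x)^-1 by rewrite invr_ge0 ltW.
have : l2norm (A *m ((l2norm x)^-1 *: x)) <= spectral_norm A.
  apply: ub_le_sup; first by case: hs.
  by exists ((l2norm x)^-1 *: x) => //=; rewrite l2normZ// mulVf.
by rewrite -scalemxAr l2normZ// mulrC ler_pdivrMr.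
Qed.

Lemma spectral_norm_ge0 m n (A : 'M[R]_(m, n)) : 0 <= spectral_norm A.
Proof.
rewrite leNgt; apply/negP => N0.
have [A0|[x Ax]] : (forall x, l2norm (A *m x) = 0) \/ exists x, l2norm (A *m x) != 0.
  by case: (pselect (exists x, l2norm (A *m x) != 0)) => [|/forallNP h]; [right|left => x;
    apply/eqP/negPn/negP].
  suff : spectral_norm A = 0 by move=> N; rewrite N ltxx in N0.
  rewrite /spectral_norm (_ : [set _ | _ in _] = [set 0]) ?sup1//.
  apply/seteqP; split => [_ [x _ <-]/=|_ -> /=]; first exact: A0.
  exists 0 => /=; last exact: A0.
  by rewrite /l2norm big1 ?sqrtr0// => i _; rewrite mxE expr0n.
have := l2norm_mulmx_le A x.
rewrite leNgt => /negP; apply; rewrite (@le_lt_trans _ _ 0)//.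
  by rewrite nmulr_rle0// l2norm_ge0.
by rewrite lt_neqAle eq_sym Ax l2norm_ge0.
Qed.

Lemma spectral_norm_eq0 m n (A : 'M[R]_(m, n)) : spectral_norm A = 0 -> A = 0.
Proof.
move=> N0; apply/matrixP => i j; rewrite mxE.
have := l2norm_mulmx_le A (delta_mx j 0); rewrite N0 mul0r => h.
have /eqP : l2norm (A *m delta_mx j 0) = 0 by apply/le_anti; rewrite h l2norm_ge0.
rewrite -sqrf_eq0 sqr_l2norm psumr_eq0 => [|k _]; last exact: sqr_ge0.
move=> /allP/(_ i (mem_index_enum i)); rewrite sqrf_eq0 => /eqP.
by rewrite -colE mxE.
Qed.

(** With [y] the transpose of [A] applied to [v], the squared norm [Y] of [y] is the inner product
    of [v] and [A y]. Cauchy-Schwarz gives [Y ^+ 2 <= V * N ^+ 2 * Y], and [Y] cancels unless it is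
    zero. *)
Lemma trmx_contraction m n (A : 'M[R]_(m, n)) (v : 'I_m -> R) :
  \sum_i (\sum_r A r i * v r) ^+ 2 <= spectral_norm A ^+ 2 * \sum_r v r ^+ 2.
Proof.
set N := spectral_norm A; have N0 : 0 <= N by exact: spectral_norm_ge0.
pose y : 'cV[R]_n := \col_i \sum_r A r i * v r.
set Y := \sum_i _; set V := \sum_r _.
have YE : Y = l2norm y ^+ 2.
  by rewrite sqr_l2norm; apply: eq_bigr => i _; rewrite mxE.
have V0 : 0 <= V by apply: sumr_ge0 => i _; exact: sqr_ge0.
have Y0 : 0 <= Y by rewrite YE exprn_ge0// l2norm_ge0.
have h : Y = \sum_r v r * (A *m y) r 0.
  under [RHS]eq_bigr do rewrite mxE mulr_sumr.
  rewrite exchange_big/=; apply: eq_bigr => i _.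
  rewrite expr2 {1}(_ : \sum_r A r i * v r = y i 0); last by rewrite mxE.
  by rewrite mulr_sumr; apply: eq_bigr => r _; ring.
have h2 : Y ^+ 2 <= V * (N ^+ 2 * Y).
  rewrite {1}h; apply: (le_trans (cauchy_schwarz_sum _ _)).
  apply: ler_wpM2l => //; rewrite -sqr_l2norm YE -exprMn.
  by apply: lerXn2r; rewrite ?nnegrE ?mulr_ge0 ?l2norm_ge0// l2norm_mulmx_le.
have [->|Yn0] := eqVneq Y 0; first by rewrite mulr_ge0// exprn_ge0.
have Yp : 0 < Y by rewrite lt_neqAle eq_sym Yn0.
by move: h2; rewrite mulrA expr2 ler_pM2r// mulrC.
Qed.

End norms.

Section tail.
Context d {T : measurableType d} {R : realType} (P : probability T R).

Lemma markov_event (f : T -> R) (E : set T) (c B : R) :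
  P.-integrable setT (EFin \o f) -> (forall w, 0 <= f w) -> measurable E ->
  0 < c -> 0 < B -> \int[P]_w f w <= B -> (forall w, E w -> c * B <= f w) ->
  (P E <= (c^-1)%:E)%E.
Proof.
move=> fint f0 mE c0 B0 fB Ef.
have cB0 : 0 < c * B by exact: mulr_gt0.
have : ((c * B)%:E * P E <= B%:E)%E.
  apply: (@le_trans _ _ (\int[P]_w (f w)%:E)%E); last first.
    rewrite -[leLHS]fineK; last exact: integrable_fin_num fint.
    by rewrite lee_fin.
  rewrite -[X in (_ * P X)%E]setIT -integral_indic// -ge0_integralZl//; last 2 first.
  - by apply/measurable_EFinP; exact: measurable_indic.
  - by rewrite lee_fin ltW.
  apply: ge0_le_integral => //.
  - by move=> w _; rewrite mule_ge0 ?lee_fin// ltW.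
  - apply/measurable_EFinP; apply: measurable_funM => //; exact: measurable_indic.
  - by case/integrableP: fint.
  - move=> w _; rewrite -EFinM lee_fin indicE.
    by case: (boolP (w \in E)) => [/set_mem /Ef|_] /=; rewrite ?mulr1 ?mulr0.
have [e] : exists e, P E = e%:E by exists (fine (P E)); rewrite fineK// fin_num_measure.
move=> ->; rewrite -EFinM !lee_fin => h.
by rewrite -(ler_pM2l cB0) (le_trans h)// mulrAC divff ?mul1r// gt_eqF.
Qed.

(** Factor [X - b] as [(u - v) * (u + v)]. The first factor exceeds [M * t] in absolute value; the
    second is at least [v], and also at least [t] since it dominates the first and [M >= 1], so its
    square is at least the mean of [v ^+ 2] and [t ^+ 2]. *)
Lemma sqrt_deviation (X b M tau2 : R) : 0 <= X -> 0 <= b -> 0 <= tau2 -> 1 <= M ->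
  M * Num.sqrt tau2 < `|Num.sqrt X - Num.sqrt b| ->
  2^-1 * M ^+ 2 * (tau2 * (b + tau2)) <= (X - b) ^+ 2.
Proof.
move=> X0 b0 t0 M1; set u := Num.sqrt X; set v := Num.sqrt b.
set t := Num.sqrt tau2 => h.
have u0 : 0 <= u by exact: sqrtr_ge0.
have v0 : 0 <= v by exact: sqrtr_ge0.
have t0' : 0 <= t by exact: sqrtr_ge0.
have -> : X - b = (u - v) * (u + v).
  by rewrite -(sqr_sqrtr X0) -(sqr_sqrtr b0) -/u -/v; ring.
rewrite -(sqr_sqrtr t0) -[in leLHS](sqr_sqrtr b0) -/v -/t exprMn.
have h1 : (M * t) ^+ 2 <= (u - v) ^+ 2.
  rewrite -[leRHS]real_normK ?num_real//; apply: lerXn2r; rewrite ?nnegrE ?normr_ge0//.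
    by rewrite mulr_ge0// (le_trans _ M1).
  exact: ltW.
have h2 : t ^+ 2 <= (u + v) ^+ 2.
  apply: lerXn2r; rewrite ?nnegrE ?addr_ge0//.
  apply: (@le_trans _ _ (M * t)); first by rewrite ler_peMl.
  apply: (le_trans (ltW h)); rewrite ler_norml; apply/andP; split; lra.
have h3 : v ^+ 2 <= (u + v) ^+ 2 by apply: lerXn2r; rewrite ?nnegrE ?addr_ge0// lerDr.
have -> : 2^-1 * M ^+ 2 * (t ^+ 2 * (v ^+ 2 + t ^+ 2)) =
   (M * t) ^+ 2 * (2^-1 * (v ^+ 2 + t ^+ 2)) by ring.
by apply: ler_pM; rewrite ?sqr_ge0// ?mulr_ge0 ?addr_ge0 ?sqr_ge0//; lra.
Qed.

Lemma measurable_sparse_l2norm m n (delta zeta : 'I_n -> {RV P >-> R})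
    (A : 'M[R]_(m, n)) :
  measurable_fun setT (fun w => l2norm (A *m \col_i (delta i w * zeta i w))).
Proof.
rewrite (_ : (fun w => _) = (fun w => Num.sqrt
    (\sum_r (\sum_i A r i * (delta i w * zeta i w)) ^+ 2))); last first.
  apply/funext => w; congr Num.sqrt; apply: eq_bigr => r _.
  by rewrite mxE; congr (_ ^+ 2); apply: eq_bigr => i _; rewrite mxE.
apply: measurableT_comp.
  by apply: continuous_measurable_fun; exact: sqrt_continuous.
apply: measurable_sum => r; apply: measurable_funX; apply: measurable_sum => i.
by apply: measurable_funM => //; exact: measurable_funM.
Qed.

Lemma measurable_sparse_deviation m n (delta zeta : 'I_n -> {RV P >-> R})
    (A : 'M[R]_(m, n)) (s y : R) :
  measurable [set w | y < `|l2norm (A *m \col_i (delta i w * zeta i w)) - s|].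
Proof.
pose g w := `|l2norm (A *m \col_i (delta i w * zeta i w)) - s|.
have mg : measurable_fun setT g.
  apply: measurableT_comp => //; apply: measurable_funB => //.
  exact: measurable_sparse_l2norm.
rewrite (_ : [set w | _] = g @^-1` `]y, +oo[).
  by rewrite -[X in measurable X]setTI; exact: mg.
by apply/seteqP; split => w /=; rewrite in_itv/= andbT.
Qed.

End tail.

Section sparse_tail.
Context {R : realType} (alpha : R) (alpha0 : 0 < alpha) (alpha2 : alpha <= 2).

(** Chosen so that half its square is at least [e] times the moment constant: the 2 offsets the loss
    in [sqrt_deviation], and the factor [e] becomes [expR k] after the [k]-th power. *)
Definition tail_const : R := 1 + 2 * expR 1 * moment_const (psi_const alpha).

Let C0 : 0 <= psi_const alpha.
Proof. exact: le_trans (psi_const_ge1 _). Qed.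

Let moment_const_gt0 : 0 < moment_const (psi_const alpha).
Proof.
have C1 := psi_const_ge1 alpha.
have Cp : 0 < psi_const alpha by exact: lt_le_trans C1.
have dp : 0 < diag_const (psi_const alpha).
  by rewrite /diag_const !mulr_gt0 ?expR_gt0 ?exprn_gt0.
have sp : 0 <= sqnorm_const (psi_const alpha) by rewrite /sqnorm_const; nonneg.
rewrite /moment_const mulr_gt0// ltr_wpDr//; nonneg.
Qed.

Lemma tail_const_ge1 : 1 <= tail_const.
Proof. by rewrite /tail_const lerDl; nonneg. Qed.

Context d {T : measurableType d} (P : probability T R) (m n : nat) (p l : R)
  (k : nat) (delta zeta : 'I_n -> {RV P >-> R}) (A : 'M[R]_(m, n)).
Context (p0 : 0 <= p) (p1 : p <= 1) (l1 : 1 <= l) (k0 : (0 < k)%N).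
Context (ind : independent_families delta zeta)
  (ind_delta : mutually_independent delta) (ind_zeta : mutually_independent zeta)
  (deltap : forall i, is_bernoulli p (delta i))
  (zetal : forall i, (psi_norm alpha (zeta i) < l%:E)%E)
  (zeta_mean : forall i, ('E_P[zeta i] = 0)%E)
  (zeta_var : forall i, ('V_P[zeta i] = 1)%E).
Context (AT : forall v : 'I_m -> R,
  \sum_i (\sum_r A r i * v r) ^+ 2 <= \sum_r v r ^+ 2).

Let x := sparse_family delta zeta.
Let E (f : T -> R) := \int[P]_w f w.
Let l0 : 0 <= l. Proof. exact: le_trans l1. Qed.

Let deltaint i r : P.-integrable setT (fun w => (delta i w ^+ r)%:E).
Proof. exact: bernoulli_integrable (deltap i) r. Qed.
Let zetaint i r : P.-integrable setT (fun w => (zeta i w ^+ r)%:E).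
Proof. exact: psi_norm_integrable alpha0 (zetal i). Qed.

Let efE : expectation_functional x E.
Proof. exact: sparse_expectation_functional. Qed.

Let xmoment i r : (0 < r)%N -> E (fun w => x i w ^+ r) = p * E (fun w => zeta i w ^+ r).
Proof.
move=> r0; rewrite /E /x sparse_moment//; congr (_ * _).
by rewrite /Rintegral (bernoulli_integral (deltap i) r0).
Qed.

Let zeta_even i j : (0 < j)%N ->
  0 <= E (fun w => zeta i w ^+ j.*2) <=
    2 * l ^+ j.*2 * ((j.*2)%:R / alpha) `^ ((j.*2)%:R / alpha).
Proof.
move=> j0; apply/andP; split.
  by apply: Rintegral_ge0 => w _; rewrite exprn_even_ge0// odd_double.
have j20 : (0 < j.*2)%N by rewrite double_gt0.
have := psi_norm_moment alpha0 (zetal i) j20.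
rewrite (eq_integral (fun w => (zeta i w ^+ j.*2)%:E)); last first.
  move=> w _; rewrite -normrX ger0_norm//.
  by rewrite exprn_even_ge0// odd_double.
rewrite -[X in (X <= _)%E]fineK ?lee_fin//.
exact: integrable_fin_num (zetaint i j.*2).
Qed.

Let Ex0 i : E (x i) = 0.
Proof.
have := xmoment i (ltn0Sn 0); under eq_fun do rewrite expr1.
move=> ->; have := zeta_mean i; rewrite unlock => h.
by rewrite /E /Rintegral; under eq_integral do rewrite expr1; rewrite h mulr0.
Qed.

Let Ex2 i : E (fun w => x i w ^+ 2) = p.
Proof.
rewrite xmoment//; have := zeta_var i.
rewrite /variance unlock zeta_mean unlock => h.
rewrite /E /Rintegral (eq_integral (fun w =>
  (((zeta i \- cst (fine 0%E)) * (zeta i \- cst (fine 0%E))) w)%:E)).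
  by rewrite h mulr1.
by move=> w _; rewrite -[X in X ^+ 2]subr0 expr2.
Qed.

Lemma sparse_l2norm_tail (y : R) :
  tail_const * (l ^+ 2 * k%:R `^ alpha^-1) <= y ->
  (P [set w | (y < `|l2norm (A *m \col_i (delta i w * zeta i w))
       - Num.sqrt p * frobenius_norm A|)%R] <= (expR (- k%:R))%:E)%E.
Proof.
move=> thr; pose a r i := A r i; pose X := restricted_sqnorm x a predT.
pose F2 := \sum_i gram a i i.
pose tau2 := l ^+ 4 * (k%:R * psi_scale alpha k).
have s1 : 1 <= psi_scale alpha k by exact: psi_scale_ge1.
have F20 : 0 <= F2.
  by apply: sumr_ge0 => i _; apply: sumr_ge0 => r _; rewrite -expr2 sqr_ge0.
have tau0 : 0 < tau2.
  have l0' : 0 < l by exact: lt_le_trans l1.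
  by rewrite /tau2 !mulr_gt0 ?exprn_gt0 ?ltr0n// (lt_le_trans _ s1).
have X0 w : 0 <= X w by exact: restricted_sqnorm_ge0.
have normE w : l2norm (A *m \col_i (delta i w * zeta i w)) = Num.sqrt (X w).
  congr Num.sqrt; apply: eq_bigr => r _; congr (_ ^+ 2); rewrite mxE.
  by apply: eq_bigr => i _; rewrite mxE.
have frobE : Num.sqrt p * frobenius_norm A = Num.sqrt (p * F2).
  rewrite sqrtrM//; congr (_ * Num.sqrt _); rewrite exchange_big/=.
  by apply: eq_bigr => i _; apply: eq_bigr => r _; rewrite expr2.
have tauE : Num.sqrt tau2 = l ^+ 2 * k%:R `^ alpha^-1.
  have -> : tau2 = (l ^+ 2 * k%:R `^ alpha^-1) ^+ 2.
    rewrite /tau2 mul_psi_scale// exprMn -exprM; congr (_ * _).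
    by rewrite -powR_mulrn ?powR_ge0// -powRrM mulrC.
  by rewrite sqrtr_sqr ger0_norm// mulr_ge0 ?exprn_ge0 ?powR_ge0.
have mom : E (fun w => (X w - p * F2) ^+ k.*2) <=
    (moment_const (psi_const alpha) * (tau2 * (p * F2 + tau2))) ^+ k.
  apply: (quadratic_form_moment efE p0 p1 (psi_const_ge1 alpha) l1 s1 k0 Ex0 Ex2).
  - move=> i j jk; have /andP[j0 _] := jk.
    rewrite xmoment ?double_gt0//.
    have /andP[z0 zl] := zeta_even i j0.
    (* For the Gaussian comparison the factor [p] is given up; the next bullet keeps it. *)
    apply: (@le_trans _ _ (E (fun w => zeta i w ^+ j.*2))); first by rewrite ler_piMl.
    exact: le_trans zl (psi_even_moment_le alpha0 alpha2 l0 jk).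
  - move=> i j jk.
    have -> : (fun w => (x i w ^+ 2) ^+ j.+1.*2) = (fun w => x i w ^+ (j.+1.*2).*2).
      by apply/funext => w; rewrite -exprM mul2n.
    rewrite xmoment//.
    have /andP[_ zl] := zeta_even i (isT : (0 < j.+1.*2)%N).
    have fourth := psi_fourth_moment_le alpha0 alpha2 l0 jk.
    by apply: (le_trans (ler_wpM2l p0 (le_trans zl fourth))); rewrite !mulrA.
  - exact: AT.
pose B := (moment_const (psi_const alpha) * (tau2 * (p * F2 + tau2))) ^+ k.
have B0 : 0 < B.
  by rewrite exprn_gt0// mulr_gt0// mulr_gt0// ltr_wpDl// mulr_ge0.
rewrite expRN.
have polyZ : polyfun x setT (fun w => (X w - p * F2) ^+ k.*2).
  by apply/polyfunX/polyfunB; [exact/polyfunT/polyfun_sqnorm|exact: polyfun_cst].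
apply: (markov_event (f := fun w => (X w - p * F2) ^+ k.*2) (B := B)) => //.
- exact: (polyfun_integrable (sparse_monomial_integrable ind ind_delta ind_zeta
    deltaint zetaint) polyZ).
- by move=> w; rewrite exprn_even_ge0// odd_double.
- exact: measurable_sparse_deviation.
move=> w /=; rewrite normE frobE => /(le_lt_trans thr); rewrite -tauE => h.
have pF0 : 0 <= p * F2 by exact: mulr_ge0.
have := sqrt_deviation (X0 w) pF0 (ltW tau0) tail_const_ge1 h.
(* All sides are [k]-th powers, so the claim reduces to the inequality between [tail_const] and the
   moment constant. *)
move=> dev; rewrite -mul2n exprM /B -[k%:R]mul1r expRM_natr -exprMn.
apply: lerXn2r; rewrite ?nnegrE ?sqr_ge0//; first by nonneg.
apply: (le_trans _ dev); rewrite [leLHS]mulrA; apply: ler_wpM2r; first by nonneg.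
have M1 := tail_const_ge1.
have M2 : tail_const <= tail_const ^+ 2.
  by rewrite expr2 ler_peMl// (le_trans _ M1).
by move: M2; rewrite {1}/tail_const; lra.
Qed.

End sparse_tail.

(** * Choice of the constants and reduction of the theorem to a single scale *)

Section psi_norm_facts.
Context d {T : measurableType d} {R : realType} (P : probability T R).

Lemma psi_norm_ge0 (alpha : R) (Z : {RV P >-> R}) : (0 <= psi_norm alpha Z)%E.
Proof. by apply/ereal_infP => _ [t [t0 _] <-]; rewrite lee_fin ltW. Qed.

Lemma psi_norm_le_max (alpha : R) n (X : 'I_n -> {RV P >-> R}) i :
  (psi_norm alpha (X i) <= max_psi_norm alpha X)%E.
Proof. exact: (le_bigmax _ (fun i => psi_norm alpha (X i))). Qed.

Lemma max_psi_norm_ge0 (alpha : R) n (X : 'I_n -> {RV P >-> R}) :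
  (0 < n)%N -> (0 <= max_psi_norm alpha X)%E.
Proof.
move=> n0; apply: le_trans (psi_norm_le_max alpha X (Ordinal n0)).
exact: psi_norm_ge0.
Qed.

(** The second moment is 1, so its upper bound from [psi_norm_moment] is at least 1; this keeps the
    psi-norm away from zero. *)
Lemma psi_norm_ge (alpha t : R) (Z : {RV P >-> R}) : 0 < alpha ->
  ('E_P[Z] = 0)%E -> ('V_P[Z] = 1)%E -> (psi_norm alpha Z < t%:E)%E ->
  1 <= 2 * t ^+ 2 * (2 / alpha) `^ (2 / alpha).
Proof.
move=> alpha0 Z0 Z1 Zt; rewrite -lee_fin -Z1 /variance unlock Z0 unlock.
apply: le_trans (psi_norm_moment alpha0 Zt (isT : (0 < 2)%N)).
rewrite le_eqVlt; apply/orP; left; apply/eqP; apply: eq_integral => w _.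
by rewrite real_normK ?num_real//= -[in RHS](subr0 (Z w)) expr2.
Qed.

End psi_norm_facts.

Section constant.
Context {R : realType} (alpha : R).
Let B : R := 2 * (2 / alpha) `^ (2 / alpha).
Let B0 : 0 <= B. Proof. by rewrite mulr_ge0// powR_ge0. Qed.

(** Exceeds 1, so that [psi_ratio * L] is strictly above every psi-norm, and its square exceeds [B],
    so that [psi_ratio * L >= 1]. The price is the factor [psi_ratio ^+ 2] in [threshold]. *)
Definition psi_ratio : R := 2 * (1 + B).
Definition threshold : R := tail_const alpha * psi_ratio ^+ 2.
Definition rate : R := (2 * threshold ^+ 2)^-1.

Lemma psi_ratio_gt1 : 1 < psi_ratio.
Proof. by have := B0; rewrite /psi_ratio; lra. Qed.

Lemma threshold_ge1 : 1 <= threshold.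
Proof.
rewrite -[leLHS]mulr1; apply: ler_pM => //; first exact: tail_const_ge1.
by rewrite exprn_ege1// ltW// psi_ratio_gt1.
Qed.

Lemma rate_gt0 : 0 < rate.
Proof.
by rewrite invr_gt0 mulr_gt0// exprn_gt0// (lt_le_trans _ threshold_ge1).
Qed.

Lemma psi_ratio_unit (l : R) : 0 <= l ->
  (forall t, l < t -> 1 <= 2 * t ^+ 2 * (2 / alpha) `^ (2 / alpha)) ->
  1 <= psi_ratio * l.
Proof.
move=> l0 h; rewrite leNgt; apply/negP => lt1.
have r0 : 0 < psi_ratio by rewrite (lt_trans _ psi_ratio_gt1).
have := h psi_ratio^-1; rewrite -[psi_ratio^-1]mul1r ltr_pdivlMr// mulrC => /(_ lt1).
rewrite mul1r leNgt => /negP; apply.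
have -> : 2 * psi_ratio^-1 ^+ 2 * (2 / alpha) `^ (2 / alpha) = B / psi_ratio ^+ 2.
  by rewrite exprVn /B; ring.
rewrite ltr_pdivrMr ?exprn_gt0// mul1r /psi_ratio; have := B0; nra.
Qed.

(** The choice of [rate] makes the exponent at most [1/2], and [2 * exp (- y) >= 2 * (1 - y)]. *)
Lemma small_deviation (u : R) : 0 <= u -> u <= threshold ->
  1 <= 2 * expR (- (rate * Num.min (u ^+ 2) (u `^ alpha))).
Proof.
move=> u0 uM; set mn := Num.min _ _.
have M0 : 0 < threshold by rewrite (lt_le_trans _ threshold_ge1).
have h : rate * mn <= 2^-1.
  apply: (@le_trans _ _ (rate * threshold ^+ 2)).
    apply: ler_wpM2l; first exact/ltW/rate_gt0.
    apply: (@le_trans _ _ (u ^+ 2)); first by rewrite ge_min lexx.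
    by apply: lerXn2r; rewrite ?nnegrE// ltW.
  by rewrite /rate invfM -mulrA mulVf ?mulr1// gt_eqF// exprn_gt0.
have := expR_ge1Dx (- (rate * mn)); lra.
Qed.

Lemma rate_bound_EFin (u : R) :
  (2%:E * expeR (- (rate%:E * Order.min (u%:E ^+ 2) (u%:E `^ alpha))) =
   (2 * expR (- (rate * Num.min (u ^+ 2) (u `^ alpha))))%:E)%E.
Proof. by rewrite poweR_EFin -EFin_expe -EFin_min -EFinM. Qed.

(** Take for [k] the integer part of [v = (u / threshold) ^ alpha], which is at least 1. Rounding
    loses at most half, [v < k + 1 <= 2 * k], and [threshold ^ alpha <= threshold ^ 2] because
    [alpha <= 2]; the definition of [rate] accounts for both. *)
Lemma large_deviation (u : R) : 0 < alpha -> alpha <= 2 -> threshold <= u ->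
  exists k : nat, [/\ (0 < k)%N, threshold * k%:R `^ alpha^-1 <= u &
    expR (- k%:R) <= 2 * expR (- (rate * Num.min (u ^+ 2) (u `^ alpha)))].
Proof.
move=> alpha0 alpha2 uM; have M1 := threshold_ge1.
have M0 : 0 < threshold by rewrite (lt_le_trans _ M1).
have u0 : 0 <= u by rewrite (le_trans _ uM)// ltW.
pose v := (u / threshold) `^ alpha.
have uM1 : 1 <= u / threshold by rewrite ler_pdivlMr// mul1r.
have v1 : 1 <= v.
  have {1}-> : 1 = 1 `^ alpha :> R by rewrite powR1.
  by apply: ge0_ler_powR; rewrite ?nnegrE ?(ltW alpha0) ?(le_trans _ uM1).
have /truncn_itv/andP[kv vk] : 0 <= v by rewrite (le_trans _ v1).
set k := Num.truncn v in kv vk.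
have k0 : (0 < k)%N by rewrite /k truncn_gt0.
exists k; split => //.
  have : k%:R `^ alpha^-1 <= v `^ alpha^-1.
    by apply: ge0_ler_powR; rewrite ?nnegrE ?invr_ge0 ?powR_ge0 ?(ltW alpha0).
  rewrite /v -powRrM mulfV ?gt_eqF// powRr1; first by rewrite ler_pdivlMr// mulrC.
  exact: le_trans uM1.
apply: (@le_trans _ _ (expR (- (rate * Num.min (u ^+ 2) (u `^ alpha))))); last first.
  by rewrite ler_peMl ?expR_ge0// ler1n.
rewrite ler_expR lerN2; apply: (@le_trans _ _ (rate * u `^ alpha)).
  apply: ler_wpM2l; first exact/ltW/rate_gt0.
  by rewrite ge_min lexx orbT.
have vE : u `^ alpha = v * threshold `^ alpha.
  by rewrite -powRM ?(le_trans _ uM1) ?(ltW M0)// divfK// gt_eqF.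
have Ma : threshold `^ alpha <= threshold ^+ 2.
  by rewrite -powR_mulrn ?(ltW M0)//; apply: ler_powR.
apply: (@le_trans _ _ (rate * (v * threshold ^+ 2))).
  apply: ler_wpM2l; first exact/ltW/rate_gt0.
  by rewrite vE; apply: ler_wpM2l => //; rewrite (le_trans _ v1).
have -> : rate * (v * threshold ^+ 2) = 2^-1 * v.
  by rewrite /rate; field; rewrite gt_eqF.
have k1 : 1 <= k%:R :> R by rewrite ler1n.
by move: vk; rewrite -natr1; lra.
Qed.

End constant.

Theorem theorem5 (R : realType) (alpha : R)
  (alpha_gt0 : 0 < alpha) (alpha_le2 : alpha <= 2) :
  exists2 c : R, 0 < c &
  forall (m n : nat) (p : R) (d : measure_display) (T : measurableType d)
    (P : probability T R) (delta zeta : 'I_n -> {RV P >-> R})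
    (A : 'M[R]_(m, n)),
    (0 < m)%N -> (0 < n)%N -> 0 <= p -> p <= 1 ->
    independent_families delta zeta ->
    mutually_independent delta ->
    (forall i, is_bernoulli p (delta i)) ->
    mutually_independent zeta ->
    (forall i, sub_exponential alpha (zeta i)) ->
    (forall i, 'E_P[zeta i] = 0)%E ->
    (forall i, 'V_P[zeta i] = 1)%E ->
    let xi (w : T) : 'cV[R]_n := \col_i (delta i w * zeta i w) in
    let L : \bar R := max_psi_norm alpha zeta in
    forall t : R, 0 <= t ->
    let q : \bar R := ediv t (spectral_norm A) in
    (P [set w | L ^+ 2 * t%:E <
          (`| l2norm (A *m xi w) - Num.sqrt p * frobenius_norm A |%R)%:E ]
     <= 2%:E * expeR (- (c%:E * Order.min (q ^+ 2) (q `^ alpha))))%E.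
Proof.
exists (rate alpha); first exact: rate_gt0.
move=> m n p d T P delta zeta A m0 n0 p0 p1 ind ind_delta deltap ind_zeta _
  zeta_mean zeta_var xi L t t0; cbv zeta.
set N := spectral_norm A; set q := ediv t N; set s := Num.sqrt p * _.
have N0 : 0 <= N by exact: spectral_norm_ge0.
have L0 : (0 <= L)%E by exact: max_psi_norm_ge0.
have small (B : set T) : measurable B -> forall u, 0 <= u -> u <= threshold alpha ->
    q = u%:E -> (P B <= 2%:E * expeR (- ((rate alpha)%:E * Order.min (q ^+ 2) (q `^ alpha))))%E.
  move=> mB u u0 uM ->; rewrite rate_bound_EFin.
  apply: (le_trans (probability_le1 P mB)).
  by rewrite lee_fin small_deviation.
have empty : (forall w, ~~ (L ^+ 2 * t%:E < (`|l2norm (A *m xi w) - s|)%:E)%E) ->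
    (P [set w | L ^+ 2 * t%:E < (`|l2norm (A *m xi w) - s|)%:E] <=
     2%:E * expeR (- ((rate alpha)%:E * Order.min (q ^+ 2) (q `^ alpha))))%E.
  move=> h; rewrite (_ : [set w | _] = set0).
    by rewrite measure0 mule_ge0// expeR_ge0.
  by apply/seteqP; split => w //=; apply/negP/h.
(* For [A = 0] the deviation is zero and cannot exceed a nonnegative extended real, whatever the
   value of [q]. *)
have [N00|Nn0] := eqVneq N 0.
  have A0 : A = 0 by exact: spectral_norm_eq0.
  apply: empty => w.
  have -> : l2norm (A *m xi w) = 0.
    by rewrite A0 mul0mx /l2norm big1 ?sqrtr0// => r _; rewrite mxE expr0n.
  have -> : s = 0.
    rewrite /s A0 /frobenius_norm big1 ?sqrtr0 ?mulr0// => r _.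
    by rewrite big1// => i _; rewrite mxE expr0n.
  by rewrite subrr normr0 -leNgt mule_ge0// ?expe_ge0// lee_fin.
have Np : 0 < N by rewrite lt_neqAle eq_sym Nn0.
have u0 : 0 <= t / N by rewrite divr_ge0.
have qE : q = (t / N)%:E by rewrite /q /ediv inver (negbTE Nn0).
have psi_le i : (psi_norm alpha (zeta i) <= L)%E by exact: psi_norm_le_max.
(* For infinite [L], a positive [t] makes the event empty. At [t = 0] the convention [+oo * 0 = 0]
   leaves an event that may be nonempty, but then [q = 0] and the bound exceeds 1. *)
case: L L0 psi_le empty => [ell ell0 psi_le _|_ _ empty|//]; last first.
  have [t00|tn0] := eqVneq t 0.
    rewrite t00 mule0; apply: (small _ _ 0) => //.
    - exact: measurable_sparse_deviation.
    - exact: le_trans (threshold_ge1 _).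
    - by rewrite qE t00 mul0r.
  apply: empty => w; rewrite -[(+oo ^+ 2)%E]/(+oo * +oo)%E mulyy -leNgt.
  by rewrite gt0_mulye ?leey// lte_fin lt_neqAle eq_sym tn0.
have -> : [set w | (ell%:E ^+ 2 * t%:E < (`|l2norm (A *m xi w) - s|)%:E)%E] =
    [set w | ell ^+ 2 * t < `|l2norm (A *m xi w) - s|].
  by apply: eq_set => w; rewrite -EFin_expe -EFinM lte_fin.
have [uM|/ltW uM] := leP (t / N) (threshold alpha).
  by apply: small uM qE => //; exact: measurable_sparse_deviation.
have [k [k0 thr expk]] := large_deviation alpha_gt0 alpha_le2 uM.
rewrite qE rate_bound_EFin; apply: le_trans (_ : (expR (- k%:R))%:E <= _)%E; last first.
  by rewrite lee_fin.
rewrite lee_fin in ell0.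
(* [psi_ratio alpha * ell] will play the role of [l]; the existence of an index, from [n > 0], lets
   unit variance bound [ell] below. *)
have ell1 : 1 <= psi_ratio alpha * ell.
  apply: psi_ratio_unit => // y elly.
  apply: (@psi_norm_ge _ _ _ P _ _ (zeta (Ordinal n0))) => //.
  by apply: (le_lt_trans (psi_le _)); rewrite lte_fin.
have ratio1 := psi_ratio_gt1 alpha.
have ellp : 0 < ell.
  rewrite lt_neqAle ell0 andbT; apply/eqP => e0.
  by move: ell1; rewrite -e0 mulr0 ler10.
(* Both norms are homogeneous, so the event is unchanged when [t] is divided by [N], and the
   transpose of [A'] is a contraction. *)
pose A' := N^-1 *: A.
have Ni0 : 0 <= N^-1 by rewrite invr_ge0.
have AT (v : 'I_m -> R) : \sum_i (\sum_r A' r i * v r) ^+ 2 <= \sum_r v r ^+ 2.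
  have := trmx_contraction A v.
  have -> : \sum_i (\sum_r A' r i * v r) ^+ 2 =
      N^-1 ^+ 2 * \sum_i (\sum_r A r i * v r) ^+ 2.
    rewrite mulr_sumr; apply: eq_bigr => i _; rewrite -exprMn mulr_sumr.
    by congr (_ ^+ 2); apply: eq_bigr => r _; rewrite mxE mulrA.
  by rewrite exprVn ler_pdivrMl// exprn_gt0.
have psi_lt i : (psi_norm alpha (zeta i) < (psi_ratio alpha * ell)%:E)%E.
  by apply: (le_lt_trans (psi_le i)); rewrite lte_fin ltr_pMl.
have -> : [set w | ell ^+ 2 * t < `|l2norm (A *m xi w) - s|] =
    [set w | ell ^+ 2 * (t / N) <
      `|l2norm (A' *m xi w) - Num.sqrt p * frobenius_norm A'|].
  apply/seteqP; split => w /=;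
    rewrite -scalemxAl l2normZ// frobenius_normZ// [Num.sqrt p * _]mulrCA -mulrBr normrM;
    by rewrite (ger0_norm Ni0) [N^-1 * _]mulrC mulrA ltr_pM2r// invr_gt0.
apply: (sparse_l2norm_tail alpha_gt0 alpha_le2 p0 p1 ell1 k0) => //.
rewrite exprMn.
have -> : tail_const alpha * (psi_ratio alpha ^+ 2 * ell ^+ 2 * k%:R `^ alpha^-1) =
  ell ^+ 2 * (threshold alpha * k%:R `^ alpha^-1) by rewrite /threshold; ring.
by apply: ler_wpM2l => //; rewrite exprn_ge0.
Qed.
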